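(* Let $S$ be an $\mathbb H^{r\times s}$-valued Schur multiplier. Then for every $f\in\mathcal H(S)$ one has $R_0f\in\mathcal H(S)$ and $$\|R_0f\|_{\mathcal H(S)}^2\le\|f\|_{\mathcal H(S)}^2-f(0)^*f(0).$$
   Context: For $m\ge0$, $T^m_j=\frac{2(m-j+1)}{(m+1)(m+2)}$, $c_m=\sum_{j=0}^m(-1)^jT^m_j$, $P_m(x)=\frac1{c_m}\sum_{j=0}^mT^m_jx^{m-j}\overline{x}^{\,j}$. $\mathcal E=\{x\in\mathbb H:9x_0^2+x_1^2+x_2^2+x_3^2<1\}$; $(\mathbf H_2(\mathcal E))^r$ is the Hilbert space of functions $\sum_mP_mf_m$, $f_m\in\mathbb H^r$, with $\|f\|^2=\sum f_m^*f_m$. $\odot$ is the Cauchy–Kovalevskaya product, $P_n\odot S=\sum_mP_{n+m}S_m$ for $S=\sum_mP_mS_m$. An $\mathbb H^{r\times s}$-valued hyperholomorphic $S$ on $\mathcal E$ is a Schur multiplier if $K_S(x,y)=\sum_{n\ge0}\big(P_n(x)\overline{P_n(y)}I_r-(P_n\odot S)(x)((P_n\odot S)(y))^*\big)$ is positive definite on $\mathcal E$. $\mathcal H(S)$ (the de Branges–Rovnyak space) is the reproducing kernel Hilbert space of $\mathbb H^r$-valued functions with reproducing kernel $K_S$; it is contractively included in $(\mathbf H_2(\mathcal E))^r$. $R_0$ is the backward shift $R_0\big(\sum_nP_nf_n\big)=\sum_nP_nf_{n+1}$. *)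

(* Defs.v *)
From HB Require Import structures.
From mathcomp Require Import all_boot all_order all_algebra.
From mathcomp Require Import all_classical all_reals all_analysis.
From mathcomp Require Import ring lra.

Set Implicit Arguments.
Unset Strict Implicit.
Unset Printing Implicit Defensive.

Import Order.TTheory GRing.Theory Num.Theory.
Import numFieldNormedType.Exports.
Local Open Scope classical_set_scope.
Local Open Scope ring_scope.

Section Quaternions.
Variable R : realType.

Record quat := Quat { q0 : R; q1 : R; q2 : R; q3 : R }.

Definition quat_to (x : quat) : R * R * R * R := (q0 x, q1 x, q2 x, q3 x).
Definition quat_of (t : R * R * R * R) : quat :=
  let: (a, b, c, d) := t in Quat a b c d.
Lemma quat_toK : cancel quat_to quat_of. Proof. by case. Qed.

HB.instance Definition _ := Equality.copy quat (can_type quat_toK).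
HB.instance Definition _ := Choice.copy quat (can_type quat_toK).

Definition qzero := Quat 0 0 0 0.
Definition qopp x := Quat (- q0 x) (- q1 x) (- q2 x) (- q3 x).
Definition qadd x y := Quat (q0 x + q0 y) (q1 x + q1 y) (q2 x + q2 y) (q3 x + q3 y).

Lemma qaddA : associative qadd.
Proof. by move=> [? ? ? ?] [? ? ? ?] [? ? ? ?]; rewrite /qadd /=; congr Quat; ring. Qed.
Lemma qaddC : commutative qadd.
Proof. by move=> [? ? ? ?] [? ? ? ?]; rewrite /qadd /=; congr Quat; ring. Qed.
Lemma qadd0 : left_id qzero qadd.
Proof. by move=> [? ? ? ?]; rewrite /qadd /=; congr Quat; ring. Qed.
Lemma qaddN : left_inverse qzero qopp qadd.
Proof. by move=> [? ? ? ?]; rewrite /qadd /=; congr Quat; ring. Qed.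

HB.instance Definition _ := GRing.isZmodule.Build quat qaddA qaddC qadd0 qaddN.

Definition qone := Quat 1 0 0 0.
(* Hamilton product: i^2 = j^2 = k^2 = ijk = -1 *)
Definition qmul x y := Quat
  (q0 x * q0 y - q1 x * q1 y - q2 x * q2 y - q3 x * q3 y)
  (q0 x * q1 y + q1 x * q0 y + q2 x * q3 y - q3 x * q2 y)
  (q0 x * q2 y - q1 x * q3 y + q2 x * q0 y + q3 x * q1 y)
  (q0 x * q3 y + q1 x * q2 y - q2 x * q1 y + q3 x * q0 y).

Lemma qmulA : associative qmul.
Proof. by move=> [? ? ? ?] [? ? ? ?] [? ? ? ?]; rewrite /qmul /=; congr Quat; ring. Qed.
Lemma qmul1 : left_id qone qmul.
Proof. by move=> [? ? ? ?]; rewrite /qmul /=; congr Quat; ring. Qed.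
Lemma qmulr1 : right_id qone qmul.
Proof. by move=> [? ? ? ?]; rewrite /qmul /=; congr Quat; ring. Qed.
Lemma qmulDl : left_distributive qmul qadd.
Proof. by move=> [? ? ? ?] [? ? ? ?] [? ? ? ?]; rewrite /qmul /= /qadd /=; congr Quat; ring. Qed.
Lemma qmulDr : right_distributive qmul qadd.
Proof. by move=> [? ? ? ?] [? ? ? ?] [? ? ? ?]; rewrite /qmul /= /qadd /=; congr Quat; ring. Qed.
Lemma qone_neq0 : qone != 0 :> quat.
Proof. by apply/eqP => -[] /eqP; rewrite oner_eq0. Qed.

HB.instance Definition _ :=
  GRing.Zmodule_isNzRing.Build quat qmulA qmul1 qmulr1 qmulDl qmulDr qone_neq0.

Definition qreal (t : R) : quat := Quat t 0 0 0.
Definition qconj (x : quat) : quat := Quat (q0 x) (- q1 x) (- q2 x) (- q3 x).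
Definition qre (x : quat) : R := q0 x.
Definition qisreal (x : quat) : bool := [&& q1 x == 0, q2 x == 0 & q3 x == 0].
Definition qnorm2 (x : quat) : R := q0 x ^+ 2 + q1 x ^+ 2 + q2 x ^+ 2 + q3 x ^+ 2.

Definition mxadj m n (A : 'M[quat]_(m, n)) : 'M[quat]_(n, m) := (map_mx qconj A)^T.

Definition qconv (u : nat -> quat) : Prop :=
  [/\ cvgn (series (fun k => q0 (u k))), cvgn (series (fun k => q1 (u k))),
      cvgn (series (fun k => q2 (u k))) & cvgn (series (fun k => q3 (u k)))].

Definition qsum (u : nat -> quat) : quat :=
  Quat (limn (series (fun k => q0 (u k)))) (limn (series (fun k => q1 (u k))))
       (limn (series (fun k => q2 (u k)))) (limn (series (fun k => q3 (u k)))).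

Definition mxconv m n (u : nat -> 'M[quat]_(m, n)) : Prop :=
  forall i j, qconv (fun k => u k i j).

Definition mxsum m n (u : nat -> 'M[quat]_(m, n)) : 'M[quat]_(m, n) :=
  \matrix_(i, j) qsum (fun k => u k i j).

Definition Tc (m j : nat) : R := (2 * (m - j).+1)%:R / (m.+1 * m.+2)%:R.
Definition cm (m : nat) : R := \sum_(j < m.+1) (-1) ^+ j * Tc m j.
Definition Pm (m : nat) (x : quat) : quat :=
  qreal (cm m)^-1 * \sum_(j < m.+1) qreal (Tc m j) * x ^+ (m - j) * (qconj x) ^+ j.

Definition ellb (x : quat) : bool :=
  9 * q0 x ^+ 2 + q1 x ^+ 2 + q2 x ^+ 2 + q3 x ^+ 2 < 1.

Definition Ell := {x : quat | ellb x}.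

Lemma ellb0 : ellb 0.
Proof. by rewrite /ellb /= expr0n /= !addr0 mulr0 ltr01. Qed.

Definition Ell0 : Ell := exist _ 0 ellb0.

(* An H^{r x s}-valued hyperholomorphic function S = sum_m P_m S_m is
   given by its coefficient sequence Sc = (S_m).                       *)

Definition CKprod r s (Sc : nat -> 'M[quat]_(r, s)) (n : nat) (x : quat)
  : 'M[quat]_(r, s) := mxsum (fun m => Pm (n + m) x *: Sc m).

Definition KS_term r s (Sc : nat -> 'M[quat]_(r, s)) (x y : quat) (n : nat)
  : 'M[quat]_r :=
  (Pm n x * qconj (Pm n y))%:M - CKprod Sc n x *m mxadj (CKprod Sc n y).

Definition KS r s (Sc : nat -> 'M[quat]_(r, s)) (x y : Ell) : 'M[quat]_r :=
  mxsum (KS_term Sc (val x) (val y)).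

Definition posdef_kernel r (K : Ell -> Ell -> 'M[quat]_r) : Prop :=
  forall (N : nat) (y : 'I_N -> Ell) (c : 'I_N -> 'cV[quat]_r),
    let q := (\sum_(i < N) \sum_(j < N) mxadj (c i) *m K (y i) (y j) *m c j) 0 0 in
    qisreal q /\ 0 <= qre q.

Definition SchurMult r s (Sc : nat -> 'M[quat]_(r, s)) : Prop :=
  [/\ forall (n : nat) (x : Ell), mxconv (fun m => Pm (n + m) (val x) *: Sc m),
      forall x y : Ell, mxconv (KS_term Sc (val x) (val y))
    & posdef_kernel (KS Sc)].

Definition fadd r (f g : Ell -> 'cV[quat]_r) : Ell -> 'cV[quat]_r :=
  fun x => f x + g x.
Definition fsub r (f g : Ell -> 'cV[quat]_r) : Ell -> 'cV[quat]_r :=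
  fun x => f x - g x.
Definition frscale r (f : Ell -> 'cV[quat]_r) (q : quat) : Ell -> 'cV[quat]_r :=
  fun x => map_mx (fun z => z * q) (f x).

Record RKHS r (K : Ell -> Ell -> 'M[quat]_r) := {
  rk_mem : (Ell -> 'cV[quat]_r) -> Prop;
  rk_ip : (Ell -> 'cV[quat]_r) -> (Ell -> 'cV[quat]_r) -> quat;
  rk_mem_add : forall f g, rk_mem f -> rk_mem g -> rk_mem (fadd f g);
  rk_mem_scale : forall f q, rk_mem f -> rk_mem (frscale f q);
  rk_ip_addl : forall f g h, rk_mem f -> rk_mem g -> rk_mem h ->
    rk_ip (fadd f g) h = rk_ip f h + rk_ip g h;
  rk_ip_scalel : forall f g q, rk_mem f -> rk_mem g ->
    rk_ip (frscale f q) g = rk_ip f g * q;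
  rk_ip_sym : forall f g, rk_mem f -> rk_mem g -> rk_ip g f = qconj (rk_ip f g);
  rk_ip_pos : forall f, rk_mem f -> qisreal (rk_ip f f) /\ 0 <= qre (rk_ip f f);
  rk_ip_def : forall f, rk_mem f -> qre (rk_ip f f) = 0 -> forall x, f x = 0;
  rk_complete : forall u : nat -> (Ell -> 'cV[quat]_r),
    (forall n, rk_mem (u n)) ->
    (forall e : R, 0 < e -> exists N, forall m n, (N <= m)%N -> (N <= n)%N ->
        qre (rk_ip (fsub (u m) (u n)) (fsub (u m) (u n))) < e) ->
    exists g, rk_mem g /\
      ((fun n => qre (rk_ip (fsub (u n) g) (fsub (u n) g))) @ \oo --> (0 : R));
  rk_ker_mem : forall (y : Ell) (c : 'cV[quat]_r), rk_mem (fun x => K x y *m c);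
  rk_reprod : forall f (y : Ell) (c : 'cV[quat]_r), rk_mem f ->
    rk_ip f (fun x => K x y *m c) = (mxadj c *m f y) 0 0
}.

Definition l2seq r (a : nat -> 'cV[quat]_r) : Prop :=
  cvgn (series (fun m => \sum_(i < r) qnorm2 (a m i 0))).

Definition H2coef r (a : nat -> 'cV[quat]_r) (f : Ell -> 'cV[quat]_r) : Prop :=
  l2seq a /\ forall x : Ell,
    mxconv (fun m => Pm m (val x) *: a m) /\ f x = mxsum (fun m => Pm m (val x) *: a m).

(* R_0 (sum_n P_n f_n) = sum_n P_n f_{n+1} *)
Definition R0fun r (a : nat -> 'cV[quat]_r) : Ell -> 'cV[quat]_r :=
  fun x => mxsum (fun m => Pm m (val x) *: a m.+1).

End Quaternions.

(* Main.v *)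
Require Import Defs.
From HB Require Import structures.
From mathcomp Require Import all_boot all_order all_algebra.
From mathcomp Require Import all_classical all_reals all_analysis.
From mathcomp Require Import ring lra.
Import Order.TTheory GRing.Theory Num.Theory.
Import numFieldNormedType.Exports.
Local Open Scope classical_set_scope.
Local Open Scope ring_scope.

Set Implicit Arguments.
Unset Strict Implicit.
Unset Printing Implicit Defensive.

(** For a finite combination k of kernels K_S(., y) c, let U be the coefficient
    sequence of the same combination of the kernels of H_2, and V = M_S^* U, so
    that V_n = sum_m S_m^* U_(n+m). Then |k|^2 = |U|^2 - |V|^2, and
    2 Re<f, k> <= |f|^2 + |k|^2 reads
        2 Re<a, U> <= |f|^2 + |U|^2 - |M_S^* U|^2,
    where f = sum_m P_m a_m. As the combinations U are dense, this also holds for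
    the shifted sequence (a_0, U_0, U_1, ...): its image under M_S^* is (t, V)
    for some t, and dropping |t|^2 gives
        2 Re<R_0 f, k> <= |f|^2 - |a_0|^2 + |k|^2 for all k.
    By Riesz representation, R_0 f lies in H(S) with norm squared at most
    |f|^2 - |a_0|^2, and a_0 = f(0). *)

(** * Quaternionic matrices *)

(** The first inequality holds only for kernel combinations, and shifting the sequence conj(P_m(y))
    c does not in general give a sequence of the same kind; hence the density argument. The obstacle
    is that no l^2 bound for M_S^* is at hand to pass to the limit. What the convergence of S yields
    is growth: the real points of the ellipsoid are those with |t| < 1/3, and convergence at t = 1/4
    forces |S_m| <= C 4^m. Density is therefore proved in a sup norm weighted by 8^-m, against which
    this growth leaves a geometric series of ratio 1/2. Kernels at small real points reach that
    rate, since P_m(t) = t^m / c_m and 1/c_m grows only linearly. The shifted sequence is cut to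
    finite support, and only finitely many coordinates of its image are kept; dropping squares only
    weakens the inequality, so both cuts can be removed by limits. The first entry a_0 is the
    maximiser of 2 Re<a_0, v> - |v|^2, with value |a_0|^2: this is the gain in the final
    estimate. *)

Section QuaternionMatrices.
Variable R : realType.
Local Notation Q := (quat R).
Implicit Types (x y : Q) (t : R).

Lemma quat_ext x y :
  q0 x = q0 y -> q1 x = q1 y -> q2 x = q2 y -> q3 x = q3 y -> x = y.
Proof. by case: x y => [? ? ? ?] [? ? ? ?] /= -> -> -> ->. Qed.

Lemma q0D x y : q0 (x + y) = q0 x + q0 y. Proof. by []. Qed.

Lemma q0_sum I (s : seq I) (P : pred I) (F : I -> Q) :
  q0 (\sum_(i <- s | P i) F i) = \sum_(i <- s | P i) q0 (F i).
Proof. exact: (big_morph _ q0D). Qed.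
Lemma qconjD x y : qconj (x + y) = qconj x + qconj y.
Proof. by apply: quat_ext => //=; rewrite opprD. Qed.

Lemma qconj0 : qconj 0 = 0 :> Q.
Proof. by apply: quat_ext => //=; rewrite oppr0. Qed.

Lemma qconjM x y : qconj (x * y) = qconj y * qconj x.
Proof. by apply: quat_ext => /=; ring. Qed.

Lemma qconjK : involutive (@qconj R).
Proof. by move=> x; apply: quat_ext => //=; rewrite opprK. Qed.

Lemma qconj_sum I (s : seq I) (P : pred I) (F : I -> Q) :
  qconj (\sum_(i <- s | P i) F i) = \sum_(i <- s | P i) qconj (F i).
Proof. exact: (big_morph _ qconjD qconj0). Qed.

Lemma qrealC t x : qreal t * x = x * qreal t.
Proof. by apply: quat_ext => /=; ring. Qed.

Lemma qrealD t u : qreal (t + u) = qreal t + qreal u.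
Proof. by apply: quat_ext => //=; rewrite addr0. Qed.

Lemma qreal0 : qreal 0 = 0 :> Q. Proof. by []. Qed.

Lemma qreal1 : qreal 1 = 1 :> Q. Proof. by []. Qed.

Lemma qrealM t u : qreal (t * u) = qreal t * qreal u.
Proof. by apply: quat_ext => /=; ring. Qed.

Lemma qrealX t n : qreal (t ^+ n) = qreal t ^+ n.
Proof. by elim: n => [|n IH]; rewrite ?expr0 // !exprS qrealM IH. Qed.

Lemma qreal_sum I (s : seq I) (P : pred I) (F : I -> R) :
  qreal (\sum_(i <- s | P i) F i) = \sum_(i <- s | P i) qreal (F i).
Proof. exact: (big_morph _ qrealD qreal0). Qed.

Lemma qconj_qreal t : qconj (qreal t) = qreal t.
Proof. by apply: quat_ext => //=; rewrite oppr0. Qed.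

Lemma qre_mulr x t : qre (x * qreal t) = qre x * t.
Proof. by rewrite /qre /=; ring. Qed.

(** The l1 norm serves only to measure sizes and convergence, where constants are harmless; it is
    submultiplicative on quaternions and on matrices alike. *)
Definition qnorm1 x : R := `|q0 x| + `|q1 x| + `|q2 x| + `|q3 x|.

Lemma qnorm1_ge0 x : 0 <= qnorm1 x.
Proof. by rewrite /qnorm1 !addr_ge0. Qed.

Lemma qnorm1_0 : qnorm1 0 = 0.
Proof. by rewrite /qnorm1 /= normr0 !addr0. Qed.

Lemma qnorm1D x y : qnorm1 (x + y) <= qnorm1 x + qnorm1 y.
Proof.
rewrite /qnorm1 /=.
have := ler_normD (q0 x) (q0 y); have := ler_normD (q1 x) (q1 y).
have := ler_normD (q2 x) (q2 y); have := ler_normD (q3 x) (q3 y).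
lra.
Qed.

Lemma qnorm1_conj x : qnorm1 (qconj x) = qnorm1 x.
Proof. by rewrite /qnorm1 /= !normrN. Qed.

Lemma qnorm1_real t x : qnorm1 (qreal t * x) = `|t| * qnorm1 x.
Proof.
rewrite /qnorm1 /= !mul0r !subr0 !addr0 !normrM; ring.
Qed.

Lemma qnorm1M x y : qnorm1 (x * y) <= qnorm1 x * qnorm1 y.
Proof.
have tri4 (a b c d : R) : `|a + b + c + d| <= `|a| + `|b| + `|c| + `|d|.
  have := ler_normD (a + b + c) d; have := ler_normD (a + b) c.
  have := ler_normD a b; lra.
have h0 := tri4 (q0 x * q0 y) (- (q1 x * q1 y)) (- (q2 x * q2 y)) (- (q3 x * q3 y)).
have h1 := tri4 (q0 x * q1 y) (q1 x * q0 y) (q2 x * q3 y) (- (q3 x * q2 y)).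
have h2 := tri4 (q0 x * q2 y) (- (q1 x * q3 y)) (q2 x * q0 y) (q3 x * q1 y).
have h3 := tri4 (q0 x * q3 y) (q1 x * q2 y) (- (q2 x * q1 y)) (q3 x * q0 y).
move: h0 h1 h2 h3; rewrite !normrN !normrM => h0 h1 h2 h3.
rewrite /qnorm1 /=.
rewrite [leRHS](_ : _ =
 (`|q0 x| * `|q0 y| + `|q1 x| * `|q1 y| + `|q2 x| * `|q2 y| + `|q3 x| * `|q3 y|) +
 (`|q0 x| * `|q1 y| + `|q1 x| * `|q0 y| + `|q2 x| * `|q3 y| + `|q3 x| * `|q2 y|) +
 (`|q0 x| * `|q2 y| + `|q1 x| * `|q3 y| + `|q2 x| * `|q0 y| + `|q3 x| * `|q1 y|) +
 (`|q0 x| * `|q3 y| + `|q1 x| * `|q2 y| + `|q2 x| * `|q1 y| + `|q3 x| * `|q0 y|));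
  last by ring.
by rewrite !lerD.
Qed.

Lemma qnorm2M x y : qnorm2 (x * y) = qnorm2 x * qnorm2 y.
Proof. by rewrite /qnorm2 /=; ring. Qed.

Lemma qnorm2X x n : qnorm2 (x ^+ n) = qnorm2 x ^+ n.
Proof.
elim: n => [|n IH]; last by rewrite !exprS qnorm2M IH.
by rewrite !expr0 /qnorm2 /=; ring.
Qed.

Lemma qnorm2_conj x : qnorm2 (qconj x) = qnorm2 x.
Proof. by rewrite /qnorm2 /=; ring. Qed.

Lemma qnorm2_ge0 x : 0 <= qnorm2 x.
Proof. by rewrite /qnorm2 !addr_ge0 ?sqr_ge0. Qed.

(** Cauchy-Schwarz over the four components, the factor 2 being the square root of 4; the defect is
    the sum of the six squared differences. *)
Lemma qnorm1_le_sqrt x : qnorm1 x <= 2 * Num.sqrt (qnorm2 x).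
Proof.
rewrite -ler_sqr ?nnegrE ?qnorm1_ge0 ?mulr_ge0 ?sqrtr_ge0 //.
rewrite exprMn sqr_sqrtr ?qnorm2_ge0 // /qnorm1 /qnorm2.
rewrite -(real_normK (num_real (q0 x))) -(real_normK (num_real (q1 x))).
rewrite -(real_normK (num_real (q2 x))) -(real_normK (num_real (q3 x))).
set a := `|q0 x|; set b := `|q1 x|; set c := `|q2 x|; set d := `|q3 x|.
have := sqr_ge0 (a - b); have := sqr_ge0 (a - c); have := sqr_ge0 (a - d).
have := sqr_ge0 (b - c); have := sqr_ge0 (b - d); have := sqr_ge0 (c - d).
nra.
Qed.

Definition mxnorm1 m n (A : 'M[Q]_(m, n)) : R := \sum_i \sum_j qnorm1 (A i j).

Lemma mxnorm1_ge0 m n (A : 'M[Q]_(m, n)) : 0 <= mxnorm1 A.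
Proof. by apply: sumr_ge0 => i _; apply: sumr_ge0 => j _; apply: qnorm1_ge0. Qed.

Lemma mxnorm1_0 m n : mxnorm1 (0 : 'M[Q]_(m, n)) = 0.
Proof. by apply: big1 => i _; apply: big1 => j _; rewrite mxE qnorm1_0. Qed.

Lemma mxnorm1D m n (A B : 'M[Q]_(m, n)) :
  mxnorm1 (A + B) <= mxnorm1 A + mxnorm1 B.
Proof.
rewrite /mxnorm1 -big_split; apply: ler_sum => i _; rewrite -big_split.
by apply: ler_sum => j _; rewrite mxE; apply: qnorm1D.
Qed.

Lemma mxnorm1N m n (A : 'M[Q]_(m, n)) : mxnorm1 (- A) = mxnorm1 A.
Proof.
apply: eq_bigr => i _; apply: eq_bigr => j _.
by rewrite mxE /qnorm1 /= !normrN.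
Qed.

Lemma mxnorm1_sum m n I (s : seq I) (P : pred I) (F : I -> 'M[Q]_(m, n)) :
  mxnorm1 (\sum_(i <- s | P i) F i) <= \sum_(i <- s | P i) mxnorm1 (F i).
Proof.
apply: (big_ind2 (fun A t => mxnorm1 A <= t)) => //; first by rewrite mxnorm1_0.
by move=> A a B b hA hB; apply: (le_trans (mxnorm1D _ _)); apply: lerD.
Qed.

Lemma mxnorm1_entry m n (A : 'M[Q]_(m, n)) i j : qnorm1 (A i j) <= mxnorm1 A.
Proof.
rewrite /mxnorm1 (bigD1 i) //= (bigD1 j) //= -addrA lerDl.
by rewrite addr_ge0 ?sumr_ge0 // => *; rewrite ?sumr_ge0 // => *; apply: qnorm1_ge0.
Qed.

Lemma mxnorm1Z m n a (A : 'M[Q]_(m, n)) :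
  mxnorm1 (a *: A) <= qnorm1 a * mxnorm1 A.
Proof.
rewrite /mxnorm1 mulr_sumr; apply: ler_sum => i _; rewrite mulr_sumr.
by apply: ler_sum => j _; rewrite mxE; apply: qnorm1M.
Qed.

Lemma mxnorm1_realZ m n t (A : 'M[Q]_(m, n)) :
  mxnorm1 (qreal t *: A) = `|t| * mxnorm1 A.
Proof.
rewrite /mxnorm1 mulr_sumr; apply: eq_bigr => i _; rewrite mulr_sumr.
by apply: eq_bigr => j _; rewrite mxE qnorm1_real.
Qed.

Lemma mxnorm1M m n p (A : 'M[Q]_(m, n)) (B : 'M[Q]_(n, p)) :
  mxnorm1 (A *m B) <= mxnorm1 A * mxnorm1 B.
Proof.
rewrite /mxnorm1 mulr_suml; apply: ler_sum => i _.
apply: (@le_trans _ _ (\sum_j \sum_k qnorm1 (A i k) * qnorm1 (B k j))).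
  apply: ler_sum => j _; rewrite mxE.
  apply: (big_ind2 (fun a t => qnorm1 a <= t)); first by rewrite qnorm1_0.
    by move=> a t b u ha hb; apply: (le_trans (qnorm1D _ _)); apply: lerD.
  by move=> k _; apply: qnorm1M.
rewrite exchange_big mulr_suml; apply: ler_sum => k _ /=.
rewrite -mulr_sumr ler_wpM2l ?qnorm1_ge0 //.
rewrite [leRHS](bigD1 k) //= lerDl sumr_ge0 // => k' _.
by rewrite sumr_ge0 // => j _; apply: qnorm1_ge0.
Qed.

Lemma mxadjK m n (A : 'M[Q]_(m, n)) : mxadj (mxadj A) = A.
Proof. by apply/matrixP => i j; rewrite !mxE qconjK. Qed.

Lemma mxadjM m n p (A : 'M[Q]_(m, n)) (B : 'M[Q]_(n, p)) :
  mxadj (A *m B) = mxadj B *m mxadj A.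
Proof.
apply/matrixP => i j; rewrite !mxE qconj_sum; apply: eq_bigr => k _.
by rewrite !mxE qconjM.
Qed.

Lemma mxadjD m n (A B : 'M[Q]_(m, n)) : mxadj (A + B) = mxadj A + mxadj B.
Proof. by apply/matrixP => i j; rewrite !mxE qconjD. Qed.

Lemma mxadj0 m n : mxadj (0 : 'M[Q]_(m, n)) = 0.
Proof. by apply/matrixP => i j; rewrite !mxE qconj0. Qed.

Lemma mxadj_sum m n I (s : seq I) (P : pred I) (F : I -> 'M[Q]_(m, n)) :
  mxadj (\sum_(i <- s | P i) F i) = \sum_(i <- s | P i) mxadj (F i).
Proof. exact: (big_morph _ (@mxadjD m n) (@mxadj0 m n)). Qed.

Lemma mxadjB m n (A B : 'M[Q]_(m, n)) : mxadj (A - B) = mxadj A - mxadj B.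
Proof. by apply/matrixP => i j; rewrite !mxE; apply: quat_ext => /=; ring. Qed.

Lemma mxnorm1_adj m n (A : 'M[Q]_(m, n)) : mxnorm1 (mxadj A) = mxnorm1 A.
Proof.
rewrite /mxnorm1 exchange_big; apply: eq_bigr => i _; apply: eq_bigr => j _.
by rewrite !mxE qnorm1_conj.
Qed.

(** Taking the real part makes the inner product a symmetric real bilinear form, free of ordering
    issues, while pairing with all vectors still detects zero. *)
Definition rdot m (u v : 'cV[Q]_m) : R := qre ((mxadj u *m v) 0 0).

Lemma rdotE m (u v : 'cV[Q]_m) :
  rdot u v = \sum_i (q0 (u i 0) * q0 (v i 0) + q1 (u i 0) * q1 (v i 0)
                   + q2 (u i 0) * q2 (v i 0) + q3 (u i 0) * q3 (v i 0)).
Proof.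
rewrite /rdot mxE /qre q0_sum; apply: eq_bigr => i _.
by rewrite !mxE /=; ring.
Qed.

Lemma rdotC m (u v : 'cV[Q]_m) : rdot u v = rdot v u.
Proof. by rewrite !rdotE; apply: eq_bigr => i _; ring. Qed.

Lemma rdotDr m (u v w : 'cV[Q]_m) : rdot u (v + w) = rdot u v + rdot u w.
Proof. by rewrite /rdot mulmxDr mxE. Qed.

Lemma rdotDl m (u v w : 'cV[Q]_m) : rdot (u + v) w = rdot u w + rdot v w.
Proof. by rewrite !(rdotC _ w) rdotDr. Qed.

Lemma rdot0r m (u : 'cV[Q]_m) : rdot u 0 = 0.
Proof. by rewrite /rdot mulmx0 mxE. Qed.

Lemma rdot0l m (u : 'cV[Q]_m) : rdot 0 u = 0.
Proof. by rewrite rdotC rdot0r. Qed.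

Lemma rdotBr m (u v w : 'cV[Q]_m) : rdot u (v - w) = rdot u v - rdot u w.
Proof. by rewrite /rdot mulmxBr !mxE. Qed.

Lemma rdotBl m (u v w : 'cV[Q]_m) : rdot (u - v) w = rdot u w - rdot v w.
Proof. by rewrite !(rdotC _ w) rdotBr. Qed.

Lemma rdotZr m t (u v : 'cV[Q]_m) : rdot u (qreal t *: v) = t * rdot u v.
Proof. by rewrite !rdotE mulr_sumr; apply: eq_bigr => i _; rewrite !mxE /=; ring. Qed.

Lemma rdotZl m t (u v : 'cV[Q]_m) : rdot (qreal t *: u) v = t * rdot u v.
Proof. by rewrite rdotC rdotZr rdotC. Qed.

Lemma rdot_suml m I (s : seq I) (P : pred I) (F : I -> 'cV[Q]_m) v :
  rdot (\sum_(i <- s | P i) F i) v = \sum_(i <- s | P i) rdot (F i) v.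
Proof.
by apply: (big_morph (fun u => rdot u v)) => [u w|]; rewrite ?rdotDl ?rdot0l.
Qed.

Lemma rdot_sumr m I (s : seq I) (P : pred I) (F : I -> 'cV[Q]_m) v :
  rdot v (\sum_(i <- s | P i) F i) = \sum_(i <- s | P i) rdot v (F i).
Proof.
by rewrite rdotC rdot_suml; apply: eq_bigr => i _; rewrite rdotC.
Qed.

Lemma rdot_adj m n (A : 'M[Q]_(m, n)) u v :
  rdot (mxadj A *m u) v = rdot u (A *m v).
Proof. by rewrite /rdot mxadjM mxadjK mulmxA. Qed.

Lemma mxadj_scalar m a : mxadj (a%:M : 'M[Q]_m) = (qconj a)%:M.
Proof.
apply/matrixP => i j; rewrite !mxE eq_sym.
by case: (i == j); rewrite ?mulr1n ?mulr0n ?qconj0.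
Qed.

Lemma rdot_conjZ m a (u v : 'cV[Q]_m) : rdot (qconj a *: u) v = rdot u (a *: v).
Proof. by rewrite -!mul_scalar_mx -mxadj_scalar rdot_adj. Qed.

Lemma rdot_ge0 m (u : 'cV[Q]_m) : 0 <= rdot u u.
Proof. by rewrite rdotE sumr_ge0 // => i _; rewrite -!expr2 !addr_ge0 ?sqr_ge0. Qed.

Lemma rdot_eq0 m (u : 'cV[Q]_m) : (forall c, rdot c u = 0) -> u = 0.
Proof.
move=> /(_ u) /eqP; rewrite rdotE psumr_eq0; last first.
  by move=> i _; rewrite -!expr2 !addr_ge0 ?sqr_ge0.
move=> /allP h; apply/matrixP => i j; rewrite ord1 mxE.
have /eqP := h i (mem_index_enum _).
have := sqr_ge0 (q0 (u i 0)); have := sqr_ge0 (q1 (u i 0)).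
have := sqr_ge0 (q2 (u i 0)); have := sqr_ge0 (q3 (u i 0)).
rewrite -!expr2 => h3 h2 h1 h0 e.
by apply: quat_ext; apply/eqP; rewrite -sqrf_eq0; apply/eqP => /=; lra.
Qed.

Lemma ler_norm_qre x : `|qre x| <= qnorm1 x.
Proof. by rewrite /qre /qnorm1 -!addrA lerDl !addr_ge0. Qed.

Lemma rdot_le m (u v : 'cV[Q]_m) : `|rdot u v| <= mxnorm1 u * mxnorm1 v.
Proof.
rewrite (le_trans (ler_norm_qre _)) // (le_trans (mxnorm1_entry _ _ _)) //.
by rewrite (le_trans (mxnorm1M _ _)) // mxnorm1_adj.
Qed.

End QuaternionMatrices.

(** * Convergence *)

Section MatrixConvergence.
Variable R : realType.
Local Notation Q := (quat R).

Lemma cvg_sumr (I : Type) (s : seq I) (P : pred I) (F : I -> nat -> R) (l : I -> R) :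
  (forall i, P i -> F i N @[N --> \oo] --> l i) ->
  \sum_(i <- s | P i) F i N @[N --> \oo] --> \sum_(i <- s | P i) l i.
Proof. by apply: cvg_big => //; exact: add_continuous. Qed.

Lemma cvg_dominated0 (u v : nat -> R) :
  (forall N, `|u N| <= v N) -> v N @[N --> \oo] --> (0 : R) ->
  u N @[N --> \oo] --> (0 : R).
Proof.
move=> uv v0; apply/norm_cvg0P.
apply: (@squeeze_cvgr _ _ _ _ (fun=> 0) v _ _ 0 _ v0); last exact: cvg_cst.
by near=> N; rewrite normr_ge0 uv.
Unshelve. all: by end_near. Qed.

Lemma cvg_sub0r (u : nat -> R) l :
  (u N - l) @[N --> \oo] --> (0 : R) -> u N @[N --> \oo] --> l.
Proof.
move=> h; rewrite -[l]add0r (_ : u = (fun N => (u N - l) + l)).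
  by apply: cvgD h _; apply: cvg_cst.
by apply/funext => N; rewrite subrK.
Qed.

Lemma cvg_subr0 (u : nat -> R) l :
  u N @[N --> \oo] --> l -> (u N - l) @[N --> \oo] --> (0 : R).
Proof. by move=> h; rewrite -(subrr l); apply: cvgB h _; apply: cvg_cst. Qed.

Definition mxcvg m n (w : nat -> 'M[Q]_(m, n)) (W : 'M[Q]_(m, n)) : Prop :=
  mxnorm1 (w N - W) @[N --> \oo] --> (0 : R).

Lemma mxcvg_cst m n (W : 'M[Q]_(m, n)) : mxcvg (fun=> W) W.
Proof. by rewrite /mxcvg subrr mxnorm1_0; apply: cvg_cst. Qed.

(** Additivity is asked for instead of linearity so that the adjoint, which conjugates scalars, is
    covered along with right multiplication. *)
Lemma mxcvg_bounded_additive m n p q (psi : 'M[Q]_(m, n) -> 'M[Q]_(p, q)) c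
    (w : nat -> 'M[Q]_(m, n)) W :
  (forall A B, psi (A - B) = psi A - psi B) ->
  (forall A, mxnorm1 (psi A) <= c * mxnorm1 A) ->
  mxcvg w W -> mxcvg (psi \o w) (psi W).
Proof.
move=> psiB psi_le wW; apply: (@cvg_dominated0 _ (fun N => c * mxnorm1 (w N - W))).
  by move=> N /=; rewrite -psiB ger0_norm ?mxnorm1_ge0.
by rewrite -[0](mulr0 c); apply: cvgMl_tmp.
Qed.

Lemma mxcvg_mulr m n p (A : 'M[Q]_(n, p)) (w : nat -> 'M[Q]_(m, n)) W :
  mxcvg w W -> mxcvg (fun N => w N *m A) (W *m A).
Proof.
apply: (@mxcvg_bounded_additive _ _ _ _ (mulmx^~ A)) => [B C|B]; first exact: mulmxBl.
by rewrite mulrC; exact: mxnorm1M.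
Qed.

Lemma mxcvg_adj m n (w : nat -> 'M[Q]_(m, n)) W :
  mxcvg w W -> mxcvg (fun N => mxadj (w N)) (mxadj W).
Proof.
apply: (@mxcvg_bounded_additive _ _ _ _ (@mxadj R m n) 1) => [B C|B].
  exact: mxadjB.
by rewrite mxnorm1_adj mul1r.
Qed.

Lemma mxcvgD m n (v w : nat -> 'M[Q]_(m, n)) V W :
  mxcvg v V -> mxcvg w W -> mxcvg (fun N => v N + w N) (V + W).
Proof.
move=> vV wW.
apply: (@cvg_dominated0 _ (fun N => mxnorm1 (v N - V) + mxnorm1 (w N - W))).
  by move=> N; rewrite ger0_norm ?mxnorm1_ge0 // opprD addrACA mxnorm1D.
by rewrite -[0](addr0 0); apply: cvgD.
Qed.

Lemma mxcvg_sum m n I (s : seq I) (w : I -> nat -> 'M[Q]_(m, n)) W :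
  (forall i, mxcvg (w i) (W i)) ->
  mxcvg (fun N => \sum_(i <- s) w i N) (\sum_(i <- s) W i).
Proof.
move=> h; elim: s => [|i s IH].
  by under eq_fun do rewrite big_nil; rewrite big_nil; apply: mxcvg_cst.
by under eq_fun do rewrite big_cons; rewrite big_cons; apply: mxcvgD.
Qed.

Lemma mxcvg_rdot m (c : 'cV[Q]_m) w W :
  mxcvg w W -> rdot c (w N) @[N --> \oo] --> rdot c W.
Proof.
move=> wW; apply: cvg_sub0r.
apply: (@cvg_dominated0 _ (fun N => mxnorm1 c * mxnorm1 (w N - W))).
  by move=> N; rewrite -rdotBr rdot_le.
by rewrite -[0](mulr0 (mxnorm1 c)); apply: cvgMl_tmp.
Qed.

(** The difference of squares factors as the pairing of u - v with u + v, the cross terms cancelling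
    by symmetry of the real form. *)
Lemma rdot_sqrB m (u v : 'cV[Q]_m) :
  `|rdot u u - rdot v v| <= mxnorm1 (u - v) * (mxnorm1 u + mxnorm1 v).
Proof.
have -> : rdot u u - rdot v v = rdot (u - v) (u + v).
  by rewrite rdotDr !rdotBl (rdotC v u) addrA subrK.
by rewrite (le_trans (rdot_le _ _)) // ler_wpM2l ?mxnorm1_ge0 ?mxnorm1D.
Qed.

Lemma mxnorm1_le_dist m n (A B : 'M[Q]_(m, n)) :
  mxnorm1 A <= mxnorm1 B + mxnorm1 (A - B).
Proof. by rewrite -{1}(subrK B A) addrC mxnorm1D. Qed.

Lemma mxcvg_rdot_sqr m (w : nat -> 'cV[Q]_m) W :
  mxcvg w W -> rdot (w N) (w N) @[N --> \oo] --> rdot W W.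
Proof.
move=> wW; apply: cvg_sub0r.
apply: (@cvg_dominated0 _
  (fun N => mxnorm1 (w N - W) * (mxnorm1 (w N - W) + 2 * mxnorm1 W))).
  move=> N; rewrite (le_trans (rdot_sqrB _ _)) // ler_wpM2l ?mxnorm1_ge0 //.
  by have := mxnorm1_le_dist (w N) W; lra.
rewrite -[0](mul0r (0 + 2 * mxnorm1 W)); apply: cvgM => //.
by apply: cvgD => //; apply: cvg_cst.
Qed.

Lemma mxcvg_norm_le m n (w : nat -> 'M[Q]_(m, n)) W C :
  mxcvg w W -> (\forall N \near \oo, mxnorm1 (w N) <= C) -> mxnorm1 W <= C.
Proof.
move=> wW wC; have h : (C + mxnorm1 (w N - W)) @[N --> \oo] --> C + 0.
  by apply: cvgD => //; apply: cvg_cst.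
rewrite -[C]addr0; apply: (cvgr_to_ge h); near=> N.
rewrite (le_trans (mxnorm1_le_dist W (w N))) // -(mxnorm1N (W - w N)) opprB lerD2r.
by near: N.
Unshelve. all: by end_near. Qed.

Lemma mxconv_cvg m n (u : nat -> 'M[Q]_(m, n)) :
  mxconv u -> mxcvg (fun N => \sum_(0 <= k < N) u k) (mxsum u).
Proof.
move=> h; rewrite /mxcvg.
have -> : (0 : R) = \sum_(i < m) \sum_(j < n) 0.
  by rewrite big1 // => i _; rewrite big1.
apply: cvg_sumr => i _; apply: cvg_sumr => j _.
have [h0 h1 h2 h3] := h i j.
(* One argument for all four components: [q] stands for any of the projections [q0] to [q3]. *)
have aux (q : Q -> R) : (forall x y, q (x + y) = q x + q y) -> q 0 = 0 ->
    (forall x, q (- x) = - q x) ->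
    q (mxsum u i j) = limn (series (fun k => q (u k i j))) ->
    cvgn (series (fun k => q (u k i j))) ->
    `|q ((\sum_(0 <= k < N) u k - mxsum u) i j)| @[N --> \oo] --> (0 : R).
  move=> qD q0 qN ql qc.
  have /cvg_subr0/cvg_norm :
    series (fun k => q (u k i j)) @ \oo --> limn (series (fun k => q (u k i j))).
    exact: qc.
  rewrite normr0.
  rewrite (_ : (fun N => `|series _ _ - _|) =
    fun N => `|q ((\sum_(0 <= k < N) u k - mxsum u) i j)|) //.
  apply/funext => N.
  have -> (A B : 'M[Q]_(m, n)) : (A - B) i j = A i j - B i j by rewrite !mxE.
  by rewrite qD qN ql summxE (big_morph _ qD q0).
rewrite /qnorm1 (_ : 0 = 0 + 0 + 0 + 0 :> R); last by rewrite !addr0.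
apply: cvgD; first apply: cvgD; first apply: cvgD.
- by apply: (aux (@q0 R)) => //; rewrite mxE.
- by apply: (aux (@q1 R)) => //; rewrite mxE.
- by apply: (aux (@q2 R)) => //; rewrite mxE.
- by apply: (aux (@q3 R)) => //; rewrite mxE.
Qed.

Lemma mxconv_geometric m n (u : nat -> 'M[Q]_(m, n)) C q :
  0 <= q < 1 -> (forall k, mxnorm1 (u k) <= C * q ^+ k) -> mxconv u.
Proof.
move=> /andP[q0 q1] uC i j.
have aux (p : Q -> R) : (forall x, `|p x| <= qnorm1 x) ->
    cvgn (series (fun k => p (u k i j))).
  move=> hp; apply: normed_cvg; apply: (@series_le_cvg _ _ (geometric C q)).
  - by move=> k; apply: normr_ge0.
  - by move=> k; rewrite /geometric /= (le_trans _ (uC k)) ?mxnorm1_ge0.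
  - move=> k; rewrite /geometric /= (le_trans _ (uC k)) //.
    by rewrite (le_trans (hp _)) ?mxnorm1_entry.
  by apply: is_cvg_geometric_series; rewrite ger0_norm.
split; apply: aux => x; rewrite /qnorm1.
- by rewrite -!addrA lerDl !addr_ge0.
- by rewrite -!addrA addrCA lerDl !addr_ge0.
- by rewrite addrAC lerDr !addr_ge0.
- by rewrite lerDr !addr_ge0.
Qed.

Lemma geometric_partial_sum_le (C q : R) N :
  0 <= C -> 0 <= q < 1 -> \sum_(0 <= k < N) C * q ^+ k <= C / (1 - q).
Proof.
move=> C0 /andP[q0 q1].
have := @geometric_seriesE R C q; rewrite lt_eqF // => /(_ isT) /(congr1 (@^~ N)).
rewrite seriesEnat /geometric /= => ->.
by rewrite ler_wpM2r ?invr_ge0 ?subr_ge0 ?(ltW q1) // ler_piMr // gerBl exprn_ge0.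
Qed.

End MatrixConvergence.

(** * Riesz representation in a reproducing kernel space *)

Section KernelSpan.
Variables (R : realType) (r : nat).
Local Notation Q := (quat R).
Local Notation fn := (Ell R -> 'cV[Q]_r).
Local Notation combination := (seq (Ell R * 'cV[Q]_r)).
Implicit Types (l : combination) (h : fn).

Definition kspan (K : Ell R -> Ell R -> 'M[Q]_r) l : fn :=
  fun x => \sum_(p <- l) K x p.1 *m p.2.

(** For [h] in the space this is Re<h, k>, by the reproducing property. The formula makes sense for
    every function, so [h] can be tested against kernels before its membership is known. *)
Definition pairing h l : R := \sum_(p <- l) rdot p.2 (h p.1).

Definition scale_comb (t : R) l : combination :=
  [seq (p.1, qreal t *: p.2) | p <- l].

Lemma pairing_cat h l1 l2 : pairing h (l1 ++ l2) = pairing h l1 + pairing h l2.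
Proof. by rewrite /pairing big_cat. Qed.

Lemma pairing_scale h t l : pairing h (scale_comb t l) = t * pairing h l.
Proof.
by rewrite /pairing big_map mulr_sumr; apply: eq_bigr => p _; rewrite rdotZl.
Qed.

Variables (K : Ell R -> Ell R -> 'M[Q]_r) (H : RKHS K).

Definition rip (f g : fn) : R := qre (rk_ip H f g).
Local Notation mem := (rk_mem H).
Local Notation ksp := (kspan K).
Implicit Types (f g : fn).

Lemma ksp_cat l1 l2 : ksp (l1 ++ l2) = fadd (ksp l1) (ksp l2).
Proof. by apply/funext => x; rewrite /kspan big_cat. Qed.

Lemma ksp_scale t l : ksp (scale_comb t l) = frscale (ksp l) (qreal t).
Proof.
apply/funext => x; rewrite /kspan big_map /frscale; apply/matrixP => i j.
rewrite mxE !summxE mulr_suml; apply: eq_bigr => p _.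
rewrite !mxE mulr_suml; apply: eq_bigr => k _.
by rewrite mxE qrealC mulrA.
Qed.

Lemma ksp1 p : ksp [:: p] = fun x => K x p.1 *m p.2.
Proof. by apply/funext => x; rewrite /kspan big_seq1. Qed.

Lemma ksp_mem l : mem (ksp l).
Proof.
elim: l => [|p l IH].
  rewrite (_ : ksp _ = fun x => K x (Ell0 R) *m 0); first exact: rk_ker_mem.
  by apply/funext => x; rewrite /kspan big_nil mulmx0.
by rewrite -cat1s ksp_cat ksp1; apply: rk_mem_add => //; apply: rk_ker_mem.
Qed.

Lemma rip_sym f g : mem f -> mem g -> rip f g = rip g f.
Proof. by move=> mf mg; rewrite /rip (rk_ip_sym mf mg). Qed.

Lemma rip_ge0 f : mem f -> 0 <= rip f f.
Proof. by case/rk_ip_pos. Qed.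

Lemma rip_addl f g h : mem f -> mem g -> mem h ->
  rip (fadd f g) h = rip f h + rip g h.
Proof. by move=> mf mg mh; rewrite /rip (rk_ip_addl mf mg mh). Qed.

Lemma rip_scalel f g t : mem f -> mem g ->
  rip (frscale f (qreal t)) g = t * rip f g.
Proof. by move=> mf mg; rewrite /rip (rk_ip_scalel _ mf mg) qre_mulr mulrC. Qed.

Lemma rip_addr f g h : mem f -> mem g -> mem h ->
  rip h (fadd f g) = rip h f + rip h g.
Proof.
by move=> mf mg mh; rewrite !(rip_sym mh) ?rip_addl //; apply: rk_mem_add.
Qed.

Lemma rip_scaler f g t : mem f -> mem g ->
  rip g (frscale f (qreal t)) = t * rip g f.
Proof.
by move=> mf mg; rewrite !(rip_sym mg) ?rip_scalel //; apply: rk_mem_scale.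
Qed.

Lemma rip_combination f g t : mem f -> mem g ->
  rip (fadd f (frscale g (qreal t))) (fadd f (frscale g (qreal t)))
  = rip f f + 2 * t * rip f g + t ^+ 2 * rip g g.
Proof.
move=> mf mg; have mtg : mem (frscale g (qreal t)) by apply: rk_mem_scale.
have mfg : mem (fadd f (frscale g (qreal t))) by apply: rk_mem_add.
rewrite rip_addl // rip_scalel // !rip_addr // !rip_scaler // (rip_sym mg mf).
ring.
Qed.

Lemma fsubE f g : fsub f g = fadd f (frscale g (qreal (-1))).
Proof.
apply/funext => x; rewrite /fsub /fadd /frscale; congr (_ + _).
by apply/matrixP => i j; rewrite !mxE; apply: quat_ext => /=; ring.
Qed.

Lemma fsub_mem f g : mem f -> mem g -> mem (fsub f g).
Proof. by move=> mf mg; rewrite fsubE; apply/rk_mem_add/rk_mem_scale. Qed.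

Lemma rip_fsub f g : mem f -> mem g ->
  rip (fsub f g) (fsub f g) = rip f f - 2 * rip f g + rip g g.
Proof. by move=> mf mg; rewrite fsubE rip_combination //; ring. Qed.

Lemma rip_ksp f l : mem f -> rip f (ksp l) = pairing f l.
Proof.
move=> mf; elim: l => [|p l IH].
  have <- : frscale f (qreal 0) = ksp [::].
    apply/funext => x; rewrite /kspan big_nil; apply/matrixP => i j.
    by rewrite !mxE mulr0.
  by rewrite rip_scaler // mul0r /pairing big_nil.
rewrite -cat1s ksp_cat rip_addr //; try exact: ksp_mem.
by rewrite IH pairing_cat ksp1 /rip rk_reprod // /pairing big_seq1.
Qed.

(** Parallelogram identity; the half sum is again written as a kernel combination, so that a
    functional of combinations can be evaluated there. *)
Lemma rip_ksp_fsub l1 l2 :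
  rip (fsub (ksp l1) (ksp l2)) (fsub (ksp l1) (ksp l2))
  = 2 * rip (ksp l1) (ksp l1) + 2 * rip (ksp l2) (ksp l2)
    - 4 * rip (ksp (scale_comb 2^-1 (l1 ++ l2))) (ksp (scale_comb 2^-1 (l1 ++ l2))).
Proof.
have m1 := ksp_mem l1; have m2 := ksp_mem l2.
rewrite rip_fsub // ksp_scale ksp_cat.
have mfg : mem (fadd (ksp l1) (ksp l2)) by apply: rk_mem_add.
have mhfg : mem (frscale (fadd (ksp l1) (ksp l2)) (qreal 2^-1)) by apply: rk_mem_scale.
rewrite rip_scalel // rip_scaler // rip_addl // !rip_addr // (rip_sym m2 m1).
by field.
Qed.

(* The representing function is the limit of a minimising sequence of
   J = |k|^2 - 2 L(k) over finite kernel combinations k; the sequence is Cauchy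
   by the parallelogram identity. *)
Lemma rk_mem_of_bounded h C :
  (forall l, 2 * pairing h l <= C + rip (ksp l) (ksp l)) ->
  mem h /\ rip h h <= C.
Proof.
move=> hC; pose J l := rip (ksp l) (ksp l) - 2 * pairing h l.
have JC l : - C <= J l by rewrite /J; have := hC l; lra.
pose E : set R := range J.
have Einf : has_inf E.
  by split; [exists (J [::]), [::] | exists (- C) => _ [l _ <-]; apply: JC].
pose d : R := inf E; pose eps n : R := n.+1%:R^-1.
have dJ l : d <= J l.
  by apply: (inf_lbound (proj2 Einf)); exists l.
have [u uJ] : exists u : nat -> combination, forall n, J (u n) < d + eps n.
  suff /choice[u uP] : forall n, exists l, J l < d + eps n by exists u.
  move=> n.
  have [|_ [l _ <-] hl] := @inf_adherent _ E (eps n) _ Einf; last by exists l.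
  by rewrite invr_gt0 ltr0n.
have uV m n (e : R) : eps m < e -> eps n < e ->
    rip (fsub (ksp (u m)) (ksp (u n))) (fsub (ksp (u m)) (ksp (u n))) < 4 * e.
  (* The linear parts cancel in 2 J(u m) + 2 J(u n) - 4 J(midpoint), and J(midpoint) >= d, so the
     squared distance is below 4 e. *)
  move=> me ne; rewrite rip_ksp_fsub.
  have := dJ (scale_comb 2^-1 (u m ++ u n)); have := uJ m; have := uJ n.
  rewrite /J pairing_scale pairing_cat.
  rewrite mulVKf ?pnatr_eq0 //.
  lra.
have [||g [mg gu]] := @rk_complete _ _ _ H (fun n => ksp (u n)).
- by move=> n; apply: ksp_mem.
- move=> e e0; have e40 : 0 < e / 4 by rewrite divr_gt0.
  have [N _ hN] := near_infty_natSinv_lt (PosNum e40).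
  exists N => m n Nm Nn.
  have := uV m n (e / 4) (hN _ Nm) (hN _ Nn); rewrite /rip; lra.
have gl (e : R) : 0 < e -> exists n, eps n < e /\
    rip (fsub (ksp (u n)) g) (fsub (ksp (u n)) g) < e.
  move=> e0; have [N1 _ h1] := near_infty_natSinv_lt (PosNum e0).
  move/cvgrPdist_lt : gu => /(_ e e0)[N2 _ h2].
  exists (maxn N1 N2); split; first by apply: h1; rewrite /= leq_maxl.
  have /= := h2 (maxn N1 N2) (leq_maxr _ _).
  by rewrite sub0r normrN; apply: le_lt_trans; rewrite /rip ler_norm.
have gh l : pairing g l = pairing h l.
  pose v := rip (ksp l) (ksp l); have v0 : 0 <= v by apply/rip_ge0/ksp_mem.
  (* First variation: J(u n + t l) >= d while J(u n) < d + eps n. Positivity of |u n - g - t l|^2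
     replaces the pairing of [u n] with [l] by that of [g], at the cost of a second t^2 v; hence the
     factor 2. *)
  have quad (t : R) : 0 <= 2 * t * (pairing g l - pairing h l) + 2 * t ^+ 2 * v.
    rewrite leNgt; apply/negP => neg.
    set z := _ + _ in neg; have [|n [n1 n2]] := gl (- z / 2); first by lra.
    set k := ksp (u n) in n2; have mk : mem k by apply: ksp_mem.
    have mkg : mem (fsub k g) by apply: fsub_mem.
    have ml := ksp_mem l.
    have := dJ (u n ++ scale_comb t l).
    rewrite /J ksp_cat ksp_scale rip_combination // pairing_cat pairing_scale.
    rewrite -/k -/v.
    have := uJ n; rewrite /J -/k.
    have mtl : mem (frscale (ksp l) (qreal (- t))) by apply: rk_mem_scale.
    have := rip_ge0 (rk_mem_add mkg mtl); rewrite rip_combination // -/v.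
    have -> : rip (fsub k g) (ksp l) = rip k (ksp l) - pairing g l.
      rewrite fsubE rip_addl // ?rip_scalel // ?rip_ksp //; first lra.
      exact: rk_mem_scale.
    move: neg n1 n2; rewrite {1}/z.
    set a := rip k (ksp l); set b := pairing h l; set c := pairing g l.
    set W := rip (fsub k g) (fsub k g); set A := rip k k; set B := pairing h (u n).
    move=> neg n1 n2 h1 h2 h3.
    have e1 : z = 2 * t * (c - b) + 2 * t ^+ 2 * v by [].
    have e2 : 0 <= W + 2 * - t * (a - c) + t ^+ 2 * v.
      by move: h1; rewrite sqrrN.
    nra.
  set X := pairing g l - pairing h l in quad.
  suff : X = 0 by rewrite /X; lra.
  apply/eqP; rewrite -sqrf_eq0 -[_ == 0]negbK; apply/negP => X0.
  have {X0} X2 : 0 < X ^+ 2 by rewrite lt0r X0 sqr_ge0.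
  (* The minimiser of the quadratic is t = - X / (2 v); the added 1 also covers v = 0, and the value
     at - X * s is still negative. *)
  pose s := (2 * v + 1)^-1; have s0 : 0 < s by rewrite invr_gt0; lra.
  have := quad (- X * s).
  have sv : s * (2 * v + 1) = 1 by rewrite mulVf // gt_eqF //; lra.
  have -> : 2 * (- X * s) * X + 2 * (- X * s) ^+ 2 * v
      = X ^+ 2 * s * (- 2 + s * (2 * v + 1) - s) by ring.
  rewrite sv => q; have : 0 < X ^+ 2 * s by rewrite mulr_gt0.
  nra.
(* Pairing with a single kernel at x reads off Re(c^* g(x)), and all [c] together determine the
   value. *)
have <- : g = h.
  apply/funext => x; apply/eqP; rewrite -subr_eq0; apply/eqP/rdot_eq0 => c.
  by have := gh [:: (x, c)]; rewrite /pairing !big_seq1 /= rdotBr => ->; rewrite subrr.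
(* If |g|^2 exceeded C, the hypothesis on [h] would keep every |u n - g|^2 at least |g|^2 - C. *)
split => //; rewrite leNgt; apply/negP => Cg.
have [|n [_ n2]] := gl (rip g g - C); first by rewrite subr_gt0.
have := hC (u n); rewrite -gh -rip_ksp // => hn.
move: n2; rewrite rip_fsub ?(rip_sym _ mg) //; try exact: ksp_mem.
lra.
Qed.

End KernelSpan.

(** * The Appell polynomials *)

Section AppellPolynomials.
Variable R : realType.
Local Notation Q := (quat R).

Lemma sum_countdown m : \sum_(j < m.+1) (m - j).+1%:R = (m.+1 * m.+2)%:R / 2 :> R.
Proof.
elim: m => [|m IH]; first by rewrite big_ord1 subnn mul1n divff ?pnatr_eq0.
rewrite big_ord_recl subn0 (eq_bigr (fun j : 'I_m.+1 => (m - j).+1%:R)) //.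
rewrite IH !natrM -!natr1; by field.
Qed.

(** The sum (m+1) - m + (m-1) - ..., that is, c_m up to the factor (m+1)(m+2)/2. *)
Definition alternating_countdown m : R := \sum_(j < m.+1) (-1) ^+ j * (m - j).+1%:R.

(** The recursion A_(m+1) = (m+2) - A_m exchanges the two bounds, so the induction needs no split by
    parity. *)
Lemma alternating_countdown_bounds m :
  m.+1%:R / 2 <= alternating_countdown m <= m.+2%:R / 2.
Proof.
rewrite /alternating_countdown; elim: m => [|m /andP[IH1 IH2]].
  by rewrite big_ord1 subnn expr0 mul1r; apply/andP; split; lra.
rewrite big_ord_recl subn0 expr0 mul1r.
rewrite (eq_bigr (fun j : 'I_m.+1 => - ((-1) ^+ j * (m - j).+1%:R))); last first.
  by move=> j _; rewrite lift0 subSS exprS mulN1r mulNr.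
rewrite sumrN; move: IH1 IH2; rewrite -[m.+3%:R]natr1 -[m.+2%:R]natr1 -[m.+1%:R]natr1 => *; apply/andP; split; lra.
Qed.

Lemma cmE m : cm R m = 2 / (m.+1 * m.+2)%:R * alternating_countdown m.
Proof.
rewrite /cm mulr_sumr; apply: eq_bigr => j _; rewrite /Tc natrM.
set c := (-1) ^+ j; set d := (_ * _.+2)%:R; ring.
Qed.

Lemma cm_inv_bounds m : m.+1%:R <= (cm R m)^-1 <= m.+2%:R.
Proof.
have /andP[h1 h2] := alternating_countdown_bounds m; rewrite cmE.
set A := alternating_countdown m in h1 h2 *.
have n1 : 0 < m.+1%:R :> R by rewrite ltr0n.
have n2 : 0 < m.+2%:R :> R by rewrite ltr0n.
have A0 : 0 < A by apply: lt_le_trans h1; rewrite divr_gt0.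
rewrite natrM !invfM !invrK mulrAC -mulrA mulrC.
rewrite -/A [X in _ <= X <= _](_ : _ = m.+1%:R * m.+2%:R / (2 * A)); last first.
  by field; rewrite ?gt_eqF.
by rewrite ler_pdivlMr ?mulr_gt0 // ler_pdivrMr ?mulr_gt0 //; apply/andP; split; nra.
Qed.

Lemma cm_gt0 m : 0 < (cm R m)^-1.
Proof. by have /andP[h _] := cm_inv_bounds m; rewrite (lt_le_trans _ h) ?ltr0n. Qed.

Lemma Tc_ge0 m j : 0 <= Tc R m j.
Proof. by rewrite /Tc divr_ge0 ?ler0n. Qed.

Lemma sum_Tc m : \sum_(j < m.+1) Tc R m j = 1.
Proof.
under eq_bigr do rewrite /Tc natrM mulrAC.
rewrite -mulr_sumr sum_countdown.
have : (m.+1 * m.+2)%:R != 0 :> R by rewrite pnatr_eq0.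
by move: (_ * _)%:R => D D0; field.
Qed.

(** On the real axis conjugation is trivial and the weights sum to 1, so P_m is a monomial. This is
    what makes real points useful for both growth and density. *)
Lemma Pm_real m t : Pm m (qreal t : Q) = qreal ((cm R m)^-1 * t ^+ m).
Proof.
rewrite /Pm qrealM; congr (_ * _).
rewrite -[t ^+ m]mul1r -(sum_Tc m) mulr_suml qreal_sum; apply: eq_bigr => j _.
by rewrite qconj_qreal -mulrA -exprD subnK ?qrealM ?qrealX // -ltnS.
Qed.

(** Every product x^(m-j) conj(x)^j has modulus |x|^m and the weights sum to 1; m + 2 bounds 1/c_m,
    and the 2 compares the two norms. *)
Lemma Pm_norm_le m (x : Q) :
  qnorm1 (Pm m x) <= 2 * m.+2%:R * Num.sqrt (qnorm2 x) ^+ m.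
Proof.
rewrite /Pm qnorm1_real gtr0_norm ?cm_gt0 //.
have /andP[_ h] := cm_inv_bounds m.
rewrite mulrAC mulrC ler_pM ?(ltW (cm_gt0 m)) ?qnorm1_ge0 //.
apply: (@le_trans _ _ (\sum_(j < m.+1) Tc R m j * (2 * Num.sqrt (qnorm2 x) ^+ m))).
  apply: (big_ind2 (fun a t => qnorm1 a <= t)); first by rewrite qnorm1_0.
    by move=> a t b u ha hb; apply: (le_trans (qnorm1D _ _)); apply: lerD.
  move=> j _; rewrite -mulrA qnorm1_real ger0_norm ?Tc_ge0 // ler_wpM2l ?Tc_ge0 //.
  rewrite (le_trans (qnorm1_le_sqrt _)) // ler_wpM2l //.
  rewrite qnorm2M !qnorm2X qnorm2_conj -exprD subnK -1?ltnS //.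
  rewrite -{1}[qnorm2 x]sqr_sqrtr ?qnorm2_ge0 // exprAC sqrtr_sqr.
  by rewrite ger0_norm // exprn_ge0 ?sqrtr_ge0.
by rewrite -mulr_suml sum_Tc mul1r.
Qed.

(** A Bernoulli-type bound r^m (1 + m d) <= (r + d)^m absorbs the linear factor into r + d, the
    midpoint of r and 1. *)
Lemma linear_times_geometric (r : R) : 0 <= r < 1 ->
  exists C q : R, [/\ 0 <= C, 0 <= q < 1 & forall m, m.+2%:R * r ^+ m <= C * q ^+ m].
Proof.
move=> /andP[r0 r1]; pose d := (1 - r) / 2; have d0 : 0 < d by rewrite /d; lra.
exists (2 + d^-1), (r + d); split.
- by rewrite addr_ge0 ?invr_ge0 ?(ltW d0).
- by rewrite /d; apply/andP; split; lra.
move=> m; have h : r ^+ m * (1 + m%:R * d) <= (r + d) ^+ m.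
  elim: m => [|m IH]; first by rewrite !expr0 mul0r addr0 mulr1.
  rewrite !exprSr; have := ler_wpM2r _ IH; move/(_ (r + d)).
  have rm : 0 <= r ^+ m by rewrite exprn_ge0.
  have md : 0 <= m%:R * d by rewrite mulr_ge0 ?ler0n ?ltW.
  move=> IH'; apply: le_trans (IH' _); last by lra.
  rewrite -natr1 -!mulrA ler_wpM2l //.
  nra.
have rm : 0 <= r ^+ m by rewrite exprn_ge0.
have rd : r ^+ m <= (r + d) ^+ m by rewrite lerXn2r ?nnegrE //; lra.
have mr : m%:R * r ^+ m <= d^-1 * (r + d) ^+ m.
  by rewrite [leRHS]mulrC ler_pdivlMr //; lra.
by rewrite -addn2 natrD !mulrDl; lra.
Qed.

Lemma ell_norm_lt1 (x : Q) : ellb x -> Num.sqrt (qnorm2 x) < 1.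
Proof.
rewrite /ellb => h; rewrite -sqrtr1 ltr_sqrt // /qnorm2.
by have := sqr_ge0 (q0 x); lra.
Qed.

Definition geometrically_bounded (u : nat -> R) : Prop := exists C q : R,
  [/\ 0 <= C, 0 <= q < 1 & forall m, u m <= C * q ^+ m].

Lemma geometrically_bounded_le u v : (forall m, u m <= v m) ->
  geometrically_bounded v -> geometrically_bounded u.
Proof.
move=> uv [C [q [C0 q01 h]]]; exists C, q; split => // m.
exact: le_trans (uv m) (h m).
Qed.

Lemma geometrically_boundedD u v : geometrically_bounded u ->
  geometrically_bounded v -> geometrically_bounded (fun m => u m + v m).
Proof.
move=> [C [q [C0 /andP[q0 q1] h]]] [D [p [D0 /andP[p0 p1] k]]].
exists (C + D), (Num.max q p); split; first exact: addr_ge0.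
  by rewrite le_max q0 gt_max q1.
move=> m; rewrite mulrDl; apply: lerD.
  apply: (le_trans (h m)); rewrite ler_wpM2l // lerXn2r ?nnegrE ?le_max ?q0 //.
  by rewrite lexx.
apply: (le_trans (k m)); rewrite ler_wpM2l // lerXn2r ?nnegrE ?le_max ?q0 //.
by rewrite lexx orbT.
Qed.

Lemma geometrically_boundedM u A : 0 <= A -> geometrically_bounded u ->
  geometrically_bounded (fun m => u m * A).
Proof.
move=> A0 [C [q [C0 q01 h]]]; exists (C * A), q; split => //; first exact: mulr_ge0.
by move=> m; rewrite mulrAC ler_wpM2r.
Qed.

Lemma Pm_geometrically_bounded (x : Ell R) :
  geometrically_bounded (fun m => qnorm1 (Pm m (val x))).
Proof.
have [|C [q [C0 q01 h]]] := @linear_times_geometric (Num.sqrt (qnorm2 (val x))).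
  by rewrite sqrtr_ge0 ell_norm_lt1 // (valP x).
exists (2 * C), q; split => //; first by rewrite mulr_ge0.
by move=> m; rewrite (le_trans (Pm_norm_le _ _)) // -!mulrA ler_wpM2l.
Qed.

Lemma Pm0 m : Pm m (0 : Q) = (m == 0%N)%:R.
Proof.
rewrite -[0]/(qreal 0) Pm_real expr0n; case: m => [|m] /=; last by rewrite mulr0.
by rewrite mulr1 cmE /alternating_countdown big_ord1 subnn expr0 !mul1r -qreal1; congr qreal; field.
Qed.

End AppellPolynomials.

(** * Density of the kernel combinations *)

Section KernelCoefficients.
Variables (R : realType) (r : nat).
Local Notation Q := (quat R).
Local Notation combination := (seq (Ell R * 'cV[Q]_r)).
Implicit Types l : combination.

(* [kcoef l m] is the m-th coefficient of the combination
   [sum_(p <- l) sum_n P_n conj(P_n(p.1)) p.2] of kernels of H_2. *)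
Definition kcoef l m : 'cV[Q]_r := \sum_(p <- l) qconj (Pm m (val p.1)) *: p.2.

Lemma kcoef_cat l1 l2 m : kcoef (l1 ++ l2) m = kcoef l1 m + kcoef l2 m.
Proof. by rewrite /kcoef big_cat. Qed.

Lemma kcoef_scale t l m : kcoef (scale_comb t l) m = qreal t *: kcoef l m.
Proof.
rewrite /kcoef big_map scaler_sumr; apply: eq_bigr => p _ /=.
by rewrite !scalerA qrealC.
Qed.

Lemma kcoef_geometrically_bounded l :
  geometrically_bounded (fun m => mxnorm1 (kcoef l m)).
Proof.
elim: l => [|p l IH].
  exists 0, 0; split; rewrite ?lexx ?ltr01 // => m.
  by rewrite /kcoef big_nil mxnorm1_0 mul0r.
apply: (geometrically_bounded_le _ (geometrically_boundedD
  (geometrically_boundedM (mxnorm1_ge0 p.2) (Pm_geometrically_bounded p.1)) IH)).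
move=> m; rewrite /kcoef big_cons (le_trans (mxnorm1D _ _)) // lerD2r.
by rewrite (le_trans (mxnorm1Z _ _)) // qnorm1_conj.
Qed.

(** Makes |U|^2 finite by itself; the kernel series only gives convergence of the difference |U|^2 -
    |V|^2. *)
Lemma kcoef_sqr_summable l : cvgn (series (fun m => rdot (kcoef l m) (kcoef l m))).
Proof.
have [C [q [C0 /andP[q0 q1] h]]] := kcoef_geometrically_bounded l.
apply: (@series_le_cvg _ _ (geometric (C * C) q)).
- by move=> m; apply: rdot_ge0.
- by move=> m; rewrite /geometric /= !mulr_ge0 ?exprn_ge0.
- move=> m; rewrite /geometric /= (le_trans (ler_norm _)) //.
  rewrite (le_trans (rdot_le _ _)) // -mulrA mulrCA.
  rewrite ler_pM ?mxnorm1_ge0 // (le_trans (h m)) // ler_piMr //.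
  by rewrite exprn_ile1 ?(ltW q1).
by apply: is_cvg_geometric_series; rewrite ger0_norm.
Qed.

(** Moving conj(P_m(x)) across the real form turns coefficient pairings into values of the series at
    the points of [l]; only a finite sum is exchanged with the limit. *)
Lemma pairing_cvg l (b : nat -> 'cV[Q]_r) (h : Ell R -> 'cV[Q]_r) :
  (forall x : Ell R, mxconv (fun m => Pm m (val x) *: b m)) ->
  (forall x : Ell R, h x = mxsum (fun m => Pm m (val x) *: b m)) ->
  \sum_(0 <= m < N) rdot (kcoef l m) (b m) @[N --> \oo] --> pairing h l.
Proof.
move=> hb hh.
suff -> : (fun N => \sum_(0 <= m < N) rdot (kcoef l m) (b m)) =
    fun N => \sum_(p <- l) rdot p.2 (\sum_(0 <= m < N) Pm m (val p.1) *: b m).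
  by apply: cvg_sumr => p _; rewrite hh; apply/mxcvg_rdot/mxconv_cvg.
apply/funext => N; under [RHS]eq_bigr do rewrite rdot_sumr.
rewrite exchange_big; apply: eq_bigr => m _; rewrite /kcoef rdot_suml.
by apply: eq_bigr => p _; rewrite rdot_conjZ.
Qed.

Definition approximable (u : nat -> 'cV[Q]_r) : Prop :=
  forall e : R, 0 < e ->
    exists l, forall m, mxnorm1 (kcoef l m - u m) <= e * 8^-1 ^+ m.

Lemma approximable_kcoef l : approximable (kcoef l).
Proof.
move=> e e0; exists l => m.
by rewrite subrr mxnorm1_0 mulr_ge0 ?(ltW e0) // exprn_ge0.
Qed.

Lemma approximable0 : approximable (fun=> 0).
Proof.
rewrite (_ : (fun=> 0) = kcoef [::]); first exact: approximable_kcoef.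
by apply/funext => m; rewrite /kcoef big_nil.
Qed.

Lemma approximableD u v :
  approximable u -> approximable v -> approximable (fun m => u m + v m).
Proof.
move=> hu hv e e0; have e20 : 0 < e / 2 by rewrite divr_gt0.
have [l hl] := hu _ e20; have [l' hl'] := hv _ e20.
exists (l ++ l') => m; rewrite kcoef_cat opprD addrACA.
rewrite (le_trans (mxnorm1D _ _)) // (le_trans (lerD (hl m) (hl' m))) //.
by rewrite -mulrDl -splitr.
Qed.

Lemma approximableZ t u : approximable u -> approximable (fun m => qreal t *: u m).
Proof.
move=> hu e e0; have t0 : 0 < `|t| + 1 by rewrite ltr_wpDl.
have [|l hl] := hu (e / (`|t| + 1)); first by rewrite divr_gt0.
exists (scale_comb t l) => m; rewrite kcoef_scale -scalerBr mxnorm1_realZ.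
rewrite (@le_trans _ _ ((`|t| + 1) * mxnorm1 (kcoef l m - u m))) //.
  by rewrite ler_wpM2r ?mxnorm1_ge0 // lerDl.
rewrite mulrC -ler_pdivlMr // (le_trans (hl m)) //.
by rewrite mulrAC.
Qed.

Lemma approximable_sum I (s : seq I) (u : I -> nat -> 'cV[Q]_r) :
  (forall i, approximable (u i)) -> approximable (fun m => \sum_(i <- s) u i m).
Proof.
move=> hu; elim: s => [|i s IH].
  by under eq_fun do rewrite big_nil; apply: approximable0.
by under eq_fun do rewrite big_cons; apply: approximableD.
Qed.

Lemma approximable_closed u :
  (forall e : R, 0 < e -> exists2 v, approximable v &
     forall m, mxnorm1 (v m - u m) <= e * 8^-1 ^+ m) ->
  approximable u.
Proof.
move=> hu e e0; have e20 : 0 < e / 2 by rewrite divr_gt0.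
have [v hv vu] := hu _ e20; have [l hl] := hv _ e20.
exists l => m; rewrite -[_ - u m](subrKA (v m)).
rewrite (le_trans (mxnorm1D _ _)) // (le_trans (lerD (hl m) (vu m))) //.
by rewrite -mulrDl -splitr.
Qed.

Definition dirac_seq (M : nat) (c : 'cV[Q]_r) (m : nat) : 'cV[Q]_r :=
  if m == M then c else 0.

Lemma small_real_in_ell (t : R) : 0 <= t -> t < 3^-1 -> ellb (qreal t).
Proof. by move=> t0 t1; rewrite /ellb /= expr0n !addr0; nra. Qed.

Lemma kcoef_real (x : Ell R) t c m : val x = qreal t ->
  kcoef [:: (x, c)] m = qreal ((cm R m)^-1 * t ^+ m) *: c.
Proof. by move=> xt; rewrite /kcoef big_seq1 xt Pm_real qconj_qreal. Qed.

(** For t <= 1/2 the expression decreases in k, so its value at k = 0 dominates. It absorbs the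
    linear growth of 1/c_m. *)
Lemma mul_expr_le (t : R) k : 0 <= t <= 2^-1 -> k.+1%:R * t ^+ k.+1 <= t.
Proof.
move=> /andP[t0 t1]; elim: k => [|k IH]; first by rewrite mul1r.
apply: le_trans IH; rewrite exprS mulrA ler_wpM2r ?exprn_ge0 //.
have : 1 <= k.+1%:R :> R by rewrite ler1n.
by rewrite -[k.+2%:R]natr1; nra.
Qed.

(* Once the lower coefficients are removed, the real kernel at t, divided by its
   M-th coefficient, tends to the M-th unit sequence as t -> 0. *)
Lemma approximable_dirac M c : approximable (dirac_seq M c).
Proof.
elim/ltn_ind: M => M IH; apply: approximable_closed => e e0.
pose eR : R := e * 8^-1 ^+ M; have eR0 : 0 < eR by rewrite mulr_gt0 ?exprn_gt0 ?invr_gt0.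
(* For m = M + k + 1 one has 1/c_m <= m + 2 <= (M + 3)(k + 1), whence the factor M + 3. The choice
   of [s] yields both s <= 1/2 and s D <= eR, and t = s / 8 produces the weight 8^-(k+1) in the
   tail. *)
pose D : R := (M.+3)%:R * (mxnorm1 c + 1).
have D0 : 0 < D by rewrite mulr_gt0 ?ltr0n // ltr_wpDl ?mxnorm1_ge0.
pose s : R := eR / (D + 2 * eR).
have den0 : 0 < D + 2 * eR by lra.
have s0 : 0 < s by rewrite divr_gt0.
have s2 : s <= 2^-1 by rewrite ler_pdivrMr //; lra.
have sD : s * D <= eR by rewrite mulrAC ler_pdivrMr //; nra.
pose t := 8^-1 * s; have t0 : 0 < t by rewrite /t; lra.
have tE : ellb (qreal t) by apply: small_real_in_ell; rewrite /t; lra.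
pose x : Ell R := exist _ (qreal t) tE.
pose p k : R := (cm R k)^-1 * t ^+ k.
have p0 k : 0 < p k by rewrite mulr_gt0 ?cm_gt0 ?exprn_gt0.
(* The entries below M are cancelled exactly. The guard [k < M] makes each summand approximable for
   every natural k, as [approximable_sum] demands, since the induction hypothesis covers only
   smaller indices. *)
pose v m : 'cV[Q]_r := qreal (p M)^-1 *: (kcoef [:: (x, c)] m
  + \sum_(0 <= k < M) qreal (- p k) *: (if (k < M)%N then dirac_seq k c m else 0)).
exists v.
  apply/approximableZ/approximableD; first exact: approximable_kcoef.
  apply: approximable_sum => k; apply: approximableZ.
  by case: ltnP => kM; [apply: IH | apply: approximable0].
have sumE m : \sum_(0 <= k < M)
    qreal (- p k) *: (if (k < M)%N then dirac_seq k c m else 0)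
    = if (m < M)%N then qreal (- p m) *: c else 0.
  rewrite big_mkord; case: ltnP => mM.
    rewrite (bigD1 (Ordinal mM)) //= mM /dirac_seq eqxx big1 ?addr0 // => k km.
    rewrite ltn_ord ifN ?scaler0 //; apply: contra km => /eqP mk.
    by apply/eqP/val_inj.
  rewrite big1 // => k _; rewrite ltn_ord /dirac_seq ifN ?scaler0 //.
  by rewrite gtn_eqF // (leq_trans (ltn_ord k)).
move=> m; rewrite /v sumE (kcoef_real _ _ (erefl : val x = qreal t)) -/(p m) /dirac_seq.
have rhs0 : 0 <= e * 8^-1 ^+ m by rewrite mulr_ge0 ?(ltW e0) // exprn_ge0.
case: (ltngtP m M) => mM.
- by rewrite -scalerDl -qrealD subrr scale0r scaler0 subr0 mxnorm1_0.
- rewrite addr0 subr0 scalerA -qrealM mxnorm1_realZ.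
  have [k mE] : exists k, m = (M + k.+1)%N.
    by exists (m - M).-1; rewrite prednK ?subn_gt0 // subnKC // ltnW.
  rewrite ger0_norm; last by rewrite ltW // mulr_gt0 ?invr_gt0 ?p0.
  have /andP[cM _] := cm_inv_bounds R M; have /andP[_ cm'] := cm_inv_bounds R m.
  have -> : (p M)^-1 * p m = ((cm R M)^-1)^-1 * (cm R m)^-1 * t ^+ k.+1.
    rewrite /p mE exprD; have := cm_gt0 R M; have := cm_gt0 R (M + k.+1).
    have tM : 0 < t ^+ M by rewrite exprn_gt0.
    move: (t ^+ M) tM ((cm R M)^-1) ((cm R (M + k.+1))^-1) => y y0 a b b0 a0.
    by field; rewrite ?gt_eqF.
  have c1 : ((cm R M)^-1)^-1 * (cm R m)^-1 <= m.+2%:R.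
    have a1 : 1 <= (cm R M)^-1 by apply: le_trans cM; rewrite ler1n.
    rewrite mulrC ler_pdivrMr ?cm_gt0 // (le_trans cm') //.
    by rewrite ler_peMr ?ler0n.
  apply: (@le_trans _ _ (m.+2%:R * t ^+ k.+1 * mxnorm1 c)).
    by rewrite !ler_wpM2r ?mxnorm1_ge0 ?exprn_ge0 // ltW.
  have c2 : m.+2%:R <= M.+3%:R * k.+1%:R :> R.
    by rewrite -natrM ler_nat mE mulSn -2!addSn addnC leq_add2l leq_pmulr.
  rewrite [leRHS](_ : _ = eR * 8^-1 ^+ k.+1); last by rewrite /eR mE exprD mulrA.
  rewrite /t exprMn.
  have h1 : k.+1%:R * s ^+ k.+1 <= s by apply: mul_expr_le; rewrite (ltW s0) s2.
  have e8 : 0 <= 8^-1 ^+ k.+1 :> R by rewrite exprn_ge0.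
  rewrite [leLHS](_ : _ = m.+2%:R * s ^+ k.+1 * mxnorm1 c * 8^-1 ^+ k.+1); last first.
    by move: (m.+2%:R) => y; ring.
  rewrite ler_wpM2r // (le_trans _ sD) //.
  have c0 := mxnorm1_ge0 c.
  apply: (@le_trans _ _ (M.+3%:R * (k.+1%:R * s ^+ k.+1) * mxnorm1 c)).
    by rewrite ler_wpM2r // mulrA ler_wpM2r // exprn_ge0 // ltW.
  rewrite /D [leRHS]mulrCA -[leLHS]mulrA ler_wpM2l ?ler0n //.
  by rewrite ler_pM ?mulr_ge0 ?exprn_ge0 ?(ltW s0) ?ler0n // lerDl.
- rewrite mM in rhs0 *.
  by rewrite addr0 scalerA -qrealM mulVf ?gt_eqF // qreal1 scale1r subrr mxnorm1_0.
Qed.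

Lemma approximable_finite M u : (forall m, (M <= m)%N -> u m = 0) -> approximable u.
Proof.
move=> u0; rewrite (_ : u = fun m => \sum_(k < M) dirac_seq k (u k) m).
  by apply: approximable_sum => k; apply: approximable_dirac.
apply/funext => m; case: (leqP M m) => mM.
  rewrite u0 // big1 // => k _; rewrite /dirac_seq ifN //.
  by rewrite gtn_eqF // (leq_trans (ltn_ord k)).
rewrite (bigD1 (Ordinal mM)) //= /dirac_seq eqxx big1 ?addr0 // => k km.
rewrite ifN //; apply: contra km => /eqP mk.
by apply/eqP/val_inj.
Qed.

End KernelCoefficients.

(** * The energy inequality *)

Section BackwardShift.
Variables (R : realType) (r s : nat).
Local Notation Q := (quat R).
Variables (Sc : nat -> 'M[Q]_(r, s)) (HS : SchurMult Sc).
Local Notation combination := (seq (Ell R * 'cV[Q]_r)).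
Implicit Types l : combination.

(** Coefficient n of M_S^* U, defined as a finite sum through the values of P_n ⊙ S at the points of
    [l], so that no operator M_S^* has to be constructed. *)
Definition adj_coef l n : 'cV[Q]_s :=
  \sum_(p <- l) mxadj (CKprod Sc n (val p.1)) *m p.2.

Lemma adj_coef_cvg l n :
  mxcvg (fun N => \sum_(0 <= m < N) mxadj (Sc m) *m kcoef l (n + m)) (adj_coef l n).
Proof.
have [conv _ _] := HS.
suff -> : (fun N => \sum_(0 <= m < N) mxadj (Sc m) *m kcoef l (n + m)) =
    fun N => \sum_(p <- l)
      mxadj (\sum_(0 <= m < N) Pm (n + m) (val p.1) *: Sc m) *m p.2.
  apply: mxcvg_sum => p; apply/mxcvg_mulr/mxcvg_adj/mxconv_cvg; exact: conv.
apply/funext => N; under [RHS]eq_bigr do rewrite mxadj_sum mulmx_suml.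
rewrite exchange_big; apply: eq_bigr => m _; rewrite /kcoef mulmx_sumr.
apply: eq_bigr => p _.
by rewrite -!mul_scalar_mx mxadjM mxadj_scalar mulmxA.
Qed.

(** The reproducing property expands |k|^2 over pairs of points, and each [KS_term] splits into a
    product of kernel coefficients minus a product of adjoint coefficients. *)
Lemma ksp_norm_cvg (H : RKHS (KS Sc)) l :
  \sum_(0 <= n < N) (rdot (kcoef l n) (kcoef l n) - rdot (adj_coef l n) (adj_coef l n))
    @[N --> \oo] --> rip H (kspan (KS Sc) l) (kspan (KS Sc) l).
Proof.
have [_ conv _] := HS.
rewrite rip_ksp; last exact: ksp_mem.
suff -> : (fun N => \sum_(0 <= n < N)
      (rdot (kcoef l n) (kcoef l n) - rdot (adj_coef l n) (adj_coef l n))) =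
    fun N => \sum_(p <- l) rdot p.2 (\sum_(p' <- l)
      (\sum_(0 <= n < N) KS_term Sc (val p.1) (val p'.1) n) *m p'.2).
  apply: cvg_sumr => p _; apply/mxcvg_rdot/mxcvg_sum => p'.
  exact/mxcvg_mulr/mxconv_cvg.
apply/funext => N.
under [RHS]eq_bigr => p _.
  under eq_bigr do rewrite mulmx_suml.
  rewrite exchange_big rdot_sumr; over.
rewrite [RHS]exchange_big; apply: eq_bigr => n _ /=.
rewrite /kcoef /adj_coef !rdot_suml -sumrB; apply: eq_bigr => p _.
rewrite !rdot_sumr -sumrB; apply: eq_bigr => p' _.
rewrite /KS_term mulmxBl rdotBr mul_scalar_mx -scalerA -mulmxA rdot_adj.
by rewrite rdot_conjZ.
Qed.

(** At the real point 1/4 the series of S has terms 4^-m S_m / c_m, bounded by convergence, and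
    1/c_m >= 1. *)
Lemma multiplier_coef_growth : exists2 C : R, 0 <= C & forall m, mxnorm1 (Sc m) <= C * 4 ^+ m.
Proof.
have [conv _ _] := HS.
have xE : ellb (qreal (4^-1 : R)) by apply: small_real_in_ell; lra.
have := mxconv_cvg (conv 0%N (exist _ (qreal 4^-1) xE)); set W := mxsum _ => hW.
have /cvgP/cvg_seq_bounded/bounded_fun_has_ubound[B hB] := hW.
have {}hB N := hB _ (ex_intro2 _ _ N I erefl).
have B0 : 0 <= B by apply: le_trans (hB 0%N); apply: mxnorm1_ge0.
exists (B + B) => [|m]; first exact: addr_ge0.
(* [B] bounds the distance of partial sums to the limit, so one term, a difference of consecutive
   sums, is at most B + B. *)
have := lerD (hB m.+1) (hB m); rewrite -[X in _ + X <= _]mxnorm1N.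
move/(le_trans (mxnorm1D _ _)); rewrite opprB addrA subrK big_nat_recr //= addrAC subrr add0r.
rewrite add0n Pm_real mxnorm1_realZ => h.
have /andP[cM _] := cm_inv_bounds R m.
have a1 : 1 <= (cm R m)^-1 by apply: le_trans cM; rewrite ler1n.
rewrite -ler_pdivrMr ?exprn_gt0 // (le_trans _ h) // mulrC -exprVn.
rewrite ler_wpM2r ?mxnorm1_ge0 // (le_trans _ (ler_norm _)) //.
by rewrite ler_peMl // exprn_ge0.
Qed.

Lemma l2seq_bounded (a : nat -> 'cV[Q]_r) : l2seq a ->
  exists2 A : R, 0 <= A & forall m, mxnorm1 (a m) <= A.
Proof.
move=> /cvg_series_cvg_0/cvgP/cvg_seq_bounded/bounded_fun_has_ubound[B hB].
have {}hB m := hB _ (ex_intro2 _ _ m I erefl).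
have aB m : mxnorm1 (a m) <= r%:R + B.
  (* Entrywise 2 sqrt(y) <= 1 + y; the r ones account for [r%:R]. *)
  apply: le_trans (_ : \sum_(i < r) (1 + qnorm2 (a m i 0)) <= _).
    apply: ler_sum => i _; rewrite big_ord1.
    apply: (le_trans (qnorm1_le_sqrt _)).
    rewrite -{2}[qnorm2 _]sqr_sqrtr ?qnorm2_ge0 //.
    by have := sqr_ge0 (1 - Num.sqrt (qnorm2 (a m i 0))); lra.
  by rewrite big_split /= sumr_const card_ord lerD2l.
by exists (r%:R + B) => //; apply: le_trans (aB 0%N); apply: mxnorm1_ge0.
Qed.

Section Energy.
Variables (H : RKHS (KS Sc)) (f : Ell R -> 'cV[Q]_r) (a : nat -> 'cV[Q]_r).
Hypotheses (mf : rk_mem H f) (fa : H2coef a f).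

(** Summand of 2 Re<a, u> - |u|^2. *)
Definition energy (u : 'cV[Q]_r) m : R := 2 * rdot u (a m) - rdot u u.

Lemma energy_kcoef_cvg l :
  \sum_(0 <= m < N) energy (kcoef l m) m
   + \sum_(0 <= n < N) rdot (adj_coef l n) (adj_coef l n) @[N --> \oo] -->
  2 * pairing f l - rip H (kspan (KS Sc) l) (kspan (KS Sc) l).
Proof.
have [_ fx] := fa.
have h1 := @pairing_cvg _ _ l a f (fun x => proj1 (fx x)) (fun x => proj2 (fx x)).
have h2 := @ksp_norm_cvg H l.
suff -> : (fun N => \sum_(0 <= m < N) energy (kcoef l m) m
   + \sum_(0 <= n < N) rdot (adj_coef l n) (adj_coef l n)) =
   (fun N => 2 * \sum_(0 <= m < N) rdot (kcoef l m) (a m) -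
    \sum_(0 <= n < N) (rdot (kcoef l n) (kcoef l n)
       - rdot (adj_coef l n) (adj_coef l n))).
  by apply: cvgB h2; apply: cvgMl_tmp.
apply/funext => N; rewrite mulr_sumr -sumrB -big_split; apply: eq_bigr => m _ /=.
by rewrite /energy; ring.
Qed.

(** Expansion of |f - k|^2 >= 0. *)
Lemma energy_kcoef_le l :
  2 * pairing f l - rip H (kspan (KS Sc) l) (kspan (KS Sc) l) <= rip H f f.
Proof.
have ml := ksp_mem H l.
by have := rip_ge0 (fsub_mem mf ml); rewrite rip_fsub // rip_ksp //; lra.
Qed.

(** The error is expressed through [u] and v - u only: the finitely supported [u] is bounded in
    advance, its approximant [v] is not. *)
Lemma energy_dist (u v : 'cV[Q]_r) m :
  energy u m <= energy v m
    + mxnorm1 (v - u) * (2 * mxnorm1 (a m) + 2 * mxnorm1 u + mxnorm1 (v - u)).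
Proof.
have h1 := rdot_sqrB v u; have h2 := rdot_le (v - u) (a m).
have h3 := mxnorm1_le_dist v u; have h4 := mxnorm1_ge0 (v - u).
have {h1} : rdot v v - rdot u u <= mxnorm1 (v - u) * (mxnorm1 v + mxnorm1 u).
  exact: le_trans (ler_norm _) h1.
have {h2} : - (rdot v (a m) - rdot u (a m)) <= mxnorm1 (v - u) * mxnorm1 (a m).
  by rewrite -rdotBl (le_trans (ler_norm _)) // normrN.
have : mxnorm1 (v - u) * mxnorm1 v <= mxnorm1 (v - u) * (mxnorm1 u + mxnorm1 (v - u)).
  by rewrite ler_wpM2l.
by rewrite /energy; lra.
Qed.

(** Approximate [u] by kernel coefficients and let the error tend to 0. With [n0] fixed, only
    finitely many image coordinates must be controlled, and the remaining squares of the approximant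
    are nonnegative. Summing m < M loses nothing, as [u] vanishes from M on. *)
Lemma energy_finite_le M (u : nat -> 'cV[Q]_r) n0 :
  (forall m, (M <= m)%N -> u m = 0) ->
  \sum_(0 <= m < M) energy (u m) m
   + \sum_(0 <= n < n0)
       rdot (\sum_(0 <= m < M) mxadj (Sc m) *m u (n + m)%N)
            (\sum_(0 <= m < M) mxadj (Sc m) *m u (n + m)%N)
  <= rip H f f.
Proof.
move=> u0.
pose W n := \sum_(0 <= m < M) mxadj (Sc m) *m u (n + m)%N.
have [A A0 aA] := l2seq_bounded (proj1 fa).
have [C C0 SC] := multiplier_coef_growth.
pose B := \sum_(0 <= k < M) mxnorm1 (u k).
have B0 : 0 <= B by apply: sumr_ge0 => k _; apply: mxnorm1_ge0.
have uB m : mxnorm1 (u m) <= B.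
  case: (leqP M m) => [/u0->|mM]; first by rewrite mxnorm1_0.
  rewrite /B big_mkord (bigD1 (Ordinal mM)) //= lerDl sumr_ge0 // => k _.
  exact: mxnorm1_ge0.
pose D := \sum_(0 <= n < n0) mxnorm1 (W n).
have D0 : 0 <= D by apply: sumr_ge0 => k _; apply: mxnorm1_ge0.
have WD n : (n < n0)%N -> mxnorm1 (W n) <= D.
  move=> mM; rewrite /D big_mkord (bigD1 (Ordinal mM)) //= lerDl sumr_ge0 // => k _.
  exact: mxnorm1_ge0.
(* Both factors 2 are the sum of 2^-m: for the energies because 8^-m <= 2^-m, for the image because
   4^m 8^-m = 2^-m. *)
pose C1 := 2 * (2 * A + 2 * B + 1).
pose C2 := 2 * C.
pose T := C1 + n0%:R * (C2 * (2 * D + C2)).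
have C10 : 0 <= C1 by rewrite /C1; lra.
have C20 : 0 <= C2 by rewrite /C2; lra.
have T0 : 0 <= T by rewrite /T addr_ge0 // mulr_ge0 // mulr_ge0 //; lra.
set LHS := _ + _.
(* Restricting to e <= 1 makes the quadratic error terms linear in e. *)
have key (e : R) : 0 < e <= 1 -> LHS - e * T <= rip H f f.
  move=> /andP[e0 e1].
  have [l hl] := approximable_finite u0 e0.
  apply: le_trans (energy_kcoef_le l).
  apply: (cvgr_to_ge (@energy_kcoef_cvg l)).
  have VW n : mxnorm1 (adj_coef l n - W n) <= e * C2.
    have hw : mxcvg (fun N => \sum_(0 <= m < N) mxadj (Sc m) *m kcoef l (n + m) - W n)
        (adj_coef l n - W n).
      by apply: mxcvgD; [exact: adj_coef_cvg | exact: mxcvg_cst].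
    apply: (mxcvg_norm_le hw); exists M => // N /= MN.
    have -> : W n = \sum_(0 <= m < N) mxadj (Sc m) *m u (n + m)%N.
      rewrite (big_cat_nat (n := M)) //= [X in _ = _ + X]big1_seq ?addr0 // => m.
      rewrite mem_index_iota => /andP[_ /andP[Mm _]]; rewrite u0 ?mulmx0 //.
      by rewrite (leq_trans Mm) // leq_addl.
    rewrite -sumrB (le_trans (mxnorm1_sum _ _ _)) //.
    apply: (@le_trans _ _ (\sum_(0 <= m < N) (C * e) * 2^-1 ^+ m)); last first.
      apply: le_trans (geometric_partial_sum_le _ _ _) _; first exact/mulr_ge0/ltW.
        by apply/andP; split; lra.
      by rewrite /C2 (_ : 1 - 2^-1 = 2^-1 :> R) ?invrK; lra.
    apply: ler_sum => m _; rewrite -mulmxBr (le_trans (mxnorm1M _ _)) // mxnorm1_adj.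
    apply: (@le_trans _ _ ((C * 4 ^+ m) * (e * 8^-1 ^+ (n + m)))).
      by apply: ler_pM => //; exact: mxnorm1_ge0.
    apply: (@le_trans _ _ ((C * 4 ^+ m) * (e * 8^-1 ^+ m))).
      rewrite !ler_wpM2l ?mulr_ge0 ?exprn_ge0 ?(ltW e0) // exprD ler_piMl ?exprn_ge0 //.
      by rewrite exprn_ile1 //; lra.
    rewrite (_ : (2^-1 : R) = 4 * 8^-1) ?exprMn; last by lra.
    by rewrite le_eqVlt; apply/orP; left; apply/eqP; ring.
  exists (maxn M n0) => // N /=; rewrite geq_max => /andP[MN nN].
  have E1 : \sum_(0 <= m < M) energy (u m) m
      <= \sum_(0 <= m < N) energy (kcoef l m) m + e * C1.
    have -> : \sum_(0 <= m < M) energy (u m) m = \sum_(0 <= m < N) energy (u m) m.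
      rewrite [RHS](big_cat_nat (n := M)) //= [X in _ = _ + X]big1_seq ?addr0 // => m.
      rewrite mem_index_iota => /andP[_ /andP[Mm _]]; rewrite u0 // /energy !rdot0l; ring.
    apply: (@le_trans _ _ (\sum_(0 <= m < N)
       (energy (kcoef l m) m + (e * (2 * A + 2 * B + 1)) * 2^-1 ^+ m))).
      apply: ler_sum => m _; apply: (le_trans (energy_dist _ (kcoef l m) m)).
      rewrite lerD2l mulrAC; apply: ler_pM; rewrite ?mxnorm1_ge0 //.
      - have := mxnorm1_ge0 (a m); have := mxnorm1_ge0 (u m).
        have := mxnorm1_ge0 (kcoef l m - u m); lra.
      - rewrite (le_trans (hl m)) // ler_wpM2l ?(ltW e0) //.
        by rewrite lerXn2r ?nnegrE //; lra.
      have : mxnorm1 (kcoef l m - u m) <= 1.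
        rewrite (le_trans (hl m)) // mulr_ile1 ?exprn_ge0 ?(ltW e0) //.
        by rewrite exprn_ile1 //; lra.
      by have := aA m; have := uB m; lra.
    rewrite big_split /= lerD2l.
    apply: le_trans (geometric_partial_sum_le _ _ _) _.
    - by rewrite mulr_ge0 ?(ltW e0) //; lra.
    - by apply/andP; split; lra.
    by rewrite /C1 (_ : 1 - 2^-1 = 2^-1 :> R) ?invrK; lra.
  have E2 : \sum_(0 <= n < n0) rdot (W n) (W n)
      <= \sum_(0 <= n < N) rdot (adj_coef l n) (adj_coef l n)
         + e * (n0%:R * (C2 * (2 * D + C2))).
    rewrite [X in _ <= X + _](big_cat_nat (n := n0)) //=.
    have tail : 0 <= \sum_(n0 <= n < N) rdot (adj_coef l n) (adj_coef l n).
      by apply: sumr_ge0 => n _; apply: rdot_ge0.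
    suff : \sum_(0 <= n < n0) rdot (W n) (W n)
        <= \sum_(0 <= n < n0) rdot (adj_coef l n) (adj_coef l n)
           + e * (n0%:R * (C2 * (2 * D + C2))) by lra.
    apply: (@le_trans _ _ (\sum_(0 <= n < n0)
        (rdot (adj_coef l n) (adj_coef l n) + e * (C2 * (2 * D + C2))))); last first.
      by rewrite big_split /= sumr_const_nat subn0 -[X in _ + X <= _]mulr_natl (mulrCA n0%:R).
    rewrite [leLHS]big_nat_cond [leRHS]big_nat_cond.
    apply: ler_sum => n /andP[/andP[_ nn0] _].
    have h1 : rdot (W n) (W n) - rdot (adj_coef l n) (adj_coef l n)
        <= mxnorm1 (W n - adj_coef l n) * (mxnorm1 (W n) + mxnorm1 (adj_coef l n)).
      exact: le_trans (ler_norm _) (rdot_sqrB _ _).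
    have h2 := VW n; have h3 := WD n nn0.
    have h4 := mxnorm1_le_dist (adj_coef l n) (W n).
    move: h1; rewrite -(mxnorm1N (W n - _)) opprB.
    have h5 := mxnorm1_ge0 (adj_coef l n - W n).
    move: (mxnorm1 (adj_coef l n - W n)) h2 h4 h5 => z h2 h4 h5 h1.
    have h6 : e * C2 <= C2 by rewrite ler_piMl.
    have : z * (mxnorm1 (W n) + mxnorm1 (adj_coef l n)) <= (e * C2) * (2 * D + C2).
      apply: ler_pM => //. rewrite addr_ge0 ?mxnorm1_ge0 //. lra.
    lra.
  rewrite /LHS -/W /T; lra.
rewrite leNgt; apply/negP => lt.
have d0 : 0 < LHS - rip H f f by rewrite subr_gt0.
move: key d0; move: LHS (rip H f f) T T0 {lt} => L F T1 T10 key d0.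
(* This makes e T1 less than half of the supposed excess L - F, contradicting [key]. *)
pose e := Num.min 1 ((L - F) / (2 * (T1 + 1))).
have e0 : 0 < e by rewrite lt_min ltr01 divr_gt0 //; lra.
have e1 : e <= 1 by rewrite ge_min lexx.
have e2 : e * (2 * (T1 + 1)) <= L - F.
  by rewrite -ler_pdivlMr ?ge_min ?lexx ?orbT //; lra.
by have := key e; rewrite e0 e1 => /(_ isT); nra.
Qed.

Lemma backward_shift_energy_le l :
  2 * pairing (R0fun a) l <=
  rip H f f - rdot (a 0%N) (a 0%N) + rip H (kspan (KS Sc) l) (kspan (KS Sc) l).
Proof.
pose U := kcoef l; pose V := adj_coef l.
have conv (x : Ell R) : mxconv (fun m => Pm m (val x) *: a m.+1).
  have [A A0 aA] := l2seq_bounded (proj1 fa).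
  have [C [q [C0 q01 h]]] := Pm_geometrically_bounded x.
  apply: (@mxconv_geometric _ _ _ _ (C * A) q) => // m.
  rewrite (le_trans (mxnorm1Z _ _)) // mulrAC.
  by rewrite ler_pM ?mxnorm1_ge0 ?qnorm1_ge0.
have cvgp := @pairing_cvg _ _ l _ (R0fun a) conv (fun x => erefl).
have cvgU : series (fun m => rdot (U m) (U m)) @ \oo
    --> limn (series (fun m => rdot (U m) (U m))) by apply: kcoef_sqr_summable.
set Uoo := limn _ in cvgU.
(* The shifted sequence with N entries of [U] kept: its support lies below N + 1. *)
pose u N m := if m is m'.+1 then (if (m' < N)%N then U m' else 0) else a 0%N.
(* [n0] is fixed while N grows, because the truncated images converge coordinate by coordinate; [n0]
   is released only at the end, through [cvg2]. *)
have step n0 : rdot (a 0%N) (a 0%N) + 2 * pairing (R0fun a) l - Uoo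
    + \sum_(0 <= n < n0) rdot (V n) (V n) <= rip H f f.
  (* The truncation keeps U_(n+m) only for n + m < N, hence N - n terms. *)
  pose Y N n := \sum_(0 <= m < N - n) mxadj (Sc m) *m U (n + m)%N.
  have cvgY n : mxcvg (Y^~ n) (V n).
    rewrite /mxcvg -(cvg_shiftn n) /=.
    suff -> : (fun N => mxnorm1 (Y (N + n)%N n - V n)) =
      (fun N => mxnorm1 (\sum_(0 <= m < N) mxadj (Sc m) *m kcoef l (n + m) - V n)).
      exact: adj_coef_cvg.
    by apply/funext => N; rewrite /Y addnK.
  have cvg1 : (rdot (a 0%N) (a 0%N)
      + 2 * \sum_(0 <= m < N) rdot (U m) (a m.+1)
      - \sum_(0 <= m < N) rdot (U m) (U m)
      + \sum_(0 <= n < n0) rdot (Y N n) (Y N n)) @[N --> \oo] -->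
      rdot (a 0%N) (a 0%N) + 2 * pairing (R0fun a) l - Uoo
      + \sum_(0 <= n < n0) rdot (V n) (V n).
    apply: cvgD; first apply: cvgB; first apply: cvgD; first exact: cvg_cst.
    - exact: cvgMl_tmp.
    - exact: cvgU.
    by apply: cvg_sumr => n _; apply: mxcvg_rdot_sqr.
  apply: (cvgr_to_le cvg1); near=> N.
  have u0 m : (N.+1 <= m)%N -> u N m = 0.
    by case: m => // m; rewrite ltnS /= leqNgt => /negbTE->.
  (* One extra coordinate: coordinate n + 1 of the image of the shifted sequence is [Y N n], and
     coordinate 0 is the square discarded at the end. *)
  apply: le_trans (energy_finite_le n0.+1 u0).
  rewrite big_nat_recl //= [X in _ <= _ + X]big_nat_recl //=.
  rewrite [X in _ <= X + _ + _]/energy.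
  have -> : \sum_(0 <= i < N) energy (if (i < N)%N then U i else 0) i.+1
     = 2 * \sum_(0 <= m < N) rdot (U m) (a m.+1) - \sum_(0 <= m < N) rdot (U m) (U m).
    rewrite mulr_sumr -sumrB big_nat_cond [RHS]big_nat_cond.
    by apply: eq_bigr => i /andP[/andP[_ ->] _].
  have -> : \sum_(0 <= n < n0) rdot (Y N n) (Y N n) = \sum_(0 <= n < n0)
      rdot (\sum_(0 <= m < N.+1) mxadj (Sc m) *m u N (n.+1 + m)%N)
           (\sum_(0 <= m < N.+1) mxadj (Sc m) *m u N (n.+1 + m)%N).
    apply: eq_bigr => n _.
    suff -> : \sum_(0 <= m < N.+1) mxadj (Sc m) *m u N (n.+1 + m)%N = Y N n by [].
    rewrite (big_cat_nat (n := (N - n)%N)) //=; last by rewrite (leq_trans (leq_subr _ _)).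
    rewrite [X in _ + X]big1_seq ?addr0.
      rewrite /Y big_nat_cond [RHS]big_nat_cond.
      apply: eq_bigr => m /andP[/andP[_ mN] _].
      by rewrite -ltn_subRL mN.
    move=> m; rewrite mem_index_iota => /andP[_ /andP[Nm _]].
    by rewrite ifN ?mulmx0 // -leqNgt -leq_subLR.
  have := rdot_ge0 (\sum_(0 <= m < N.+1) mxadj (Sc m) *m u N (0 + m)%N).
  lra.
(* Summability of |U|^2 now separates |V|^2 from the convergent difference, giving |V|^2 = |U|^2 -
   |k|^2. *)
have cvg2 : \sum_(0 <= n < N) rdot (V n) (V n) @[N --> \oo] -->
    Uoo - rip H (kspan (KS Sc) l) (kspan (KS Sc) l).
  suff -> : (fun N => \sum_(0 <= n < N) rdot (V n) (V n)) =
    (fun N => series (fun m => rdot (U m) (U m)) N - \sum_(0 <= n < N)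
      (rdot (kcoef l n) (kcoef l n) - rdot (adj_coef l n) (adj_coef l n))).
    by apply: cvgB (@ksp_norm_cvg H l).
  apply/funext => N; rewrite /series /= -sumrB; apply: eq_bigr => n _.
  by rewrite /U /V opprB addrC subrK.
suff : Uoo - rip H (kspan (KS Sc) l) (kspan (KS Sc) l) <=
    rip H f f - (rdot (a 0%N) (a 0%N) + 2 * pairing (R0fun a) l - Uoo) by lra.
apply: (cvgr_to_le cvg2); near=> N.
by have := step N; lra.
Unshelve. all: by end_near. Qed.

(** At the origin only P_0 = 1 survives, so every partial sum from the first on equals a_0. *)
Lemma H2coef_at0 : f (Ell0 R) = a 0%N.
Proof.
have [conv ->] := proj2 fa (Ell0 R).
set W := mxsum _.
have hw : mxcvg (fun N => \sum_(0 <= m < N) Pm m (val (Ell0 R)) *: a m - a 0%N) (W - a 0%N).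
  by apply: mxcvgD; [exact: mxconv_cvg | exact: mxcvg_cst].
have W0 : mxnorm1 (W - a 0%N) <= 0.
  apply: (mxcvg_norm_le hw); exists 1%N => // -[//|N] _.
  rewrite big_nat_recl //= Pm0 scale1r big1 ?addr0 ?subrr ?mxnorm1_0 // => m _.
  by rewrite Pm0 scale0r.
apply/eqP; rewrite -subr_eq0; apply/eqP/rdot_eq0 => c.
apply/eqP; rewrite -normr_le0 (le_trans (rdot_le _ _)) //.
by rewrite mulr_ge0_le0 ?mxnorm1_ge0.
Qed.

End Energy.

End BackwardShift.

Theorem mainTheorem16 (R : realType) (r s : nat)
  (Sc : nat -> 'M[quat R]_(r, s)) (HS : SchurMult Sc)
  (H : RKHS (KS Sc))
  (f : Ell R -> 'cV[quat R]_r) (a : nat -> 'cV[quat R]_r) :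
  rk_mem H f -> H2coef a f ->
  rk_mem H (R0fun a) /\
  qre (rk_ip H (R0fun a) (R0fun a))
    <= qre (rk_ip H f f) - qre ((mxadj (f (Ell0 R)) *m f (Ell0 R)) 0 0).
Proof.
move=> mf fa; apply: rk_mem_of_bounded => l.
by rewrite (H2coef_at0 fa); apply: backward_shift_energy_le.
Qed.
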